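(* Let $\mathfrak T$ be a tower type of degree $n$ and $\mathcal C$ a set of isomorphism classes of degree $n$ number fields. Then $\mathrm{Spe}\big(\bigcup_{K\in\mathcal C}\mathcal S(\mathfrak T,K)\big)=\bigcup_{\mathcal F}P_{T_{\mathcal F}}$, where $\mathcal F$ ranges over all flags (over $\mathbb Q$) with tower type $\mathfrak T$ of number fields in $\mathcal C$.
   Context: $|x|=\sqrt{\frac1n\sum_m|\sigma_m(x)|^2}$; $\lambda_i(\Lambda)=\min\{r>0:\dim_{\mathbb Q}\mathrm{Span}_{\mathbb Q}\{x\in\Lambda:|x|\le r\}\ge i+1\}$. A tower type is $(n_1,\dots,n_t)$, integers $n_s>1$; the tower type of a tower of fields $\mathbb Q=K_0\subset\dots\subset K_t$ without trivial extensions is $([K_1:K_0],\dots,[K_t:K_{t-1}])$. The tower type of an order $\mathcal O$ in $K$ is that of the tower of exactly the fields $\mathbb Q(\{x\in\mathcal O:|x|\le r\})$, $r>0$. $\mathcal S(\mathfrak T,K)$: isomorphism classes of orders in $K$ of tower type $\mathfrak T$. Minkowski type of an infinite set $\mathcal S$ of orders: limit of $(\log_{\Delta_{\mathcal O}}\lambda_1,\dots,\log_{\Delta_{\mathcal O}}\lambda_{n-1})$ over $\mathcal O\in\mathcal S$ ($\Delta$ = absolute discriminant); $\mathrm{Spe}(\mathcal S)$ = set of Minkowski types of infinite subsets of $\mathcal S$. A flag of a degree $n$ number field $K$ is a chain of $\mathbb Q$-subspaces $\mathbb Q=F_0\subset F_1\subset\dots\subset F_{n-1}=K$ with $\dim F_i=i+1$;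 its tower type is the tower type of the tower formed by the distinct fields $\mathbb Q(F_i)$, $i\in\{0,\dots,n-1\}$. Its flag type is $T_{\mathcal F}(i,j)=\min\{k: F_iF_j\subseteq F_k\}$, where $F_iF_j=\{ab:a\in F_i,b\in F_j\}$. For a function $T:\{0,..,n-1\}^2\to\{0,..,n-1\}$ of this kind, $P_T$ is the set of $\mathbf x\in\mathbb R^{n-1}$ with $\sum x_i=1/2$, $0\le x_1\le\dots\le x_{n-1}$, and $x_{T(i,j)}\le x_i+x_j$ for all $1\le i,j<n$. *)

(* Defs.v *)
From HB Require Import structures.
From mathcomp Require Export all_boot all_order all_algebra all_field.
From mathcomp Require Export complex.
From mathcomp Require Export boolp classical_sets functions cardinality fsbigop.
From mathcomp Require Export reals exp.

Set Implicit Arguments.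
Unset Strict Implicit.
Unset Printing Implicit Defensive.

Import Order.TTheory GRing.Theory Num.Theory.

Local Open Scope classical_set_scope.
Local Open Scope ring_scope.

(* Number fields are the types K : fieldExtType rat; [K : Q] is \dim {:K}. *)

Definition field_iso (K L : fieldExtType rat) : Prop :=
  exists f : {rmorphism K -> L}, bijective f.

(* Sets of isomorphism classes of fields, and later of orders, are represented
   by isomorphism-invariant predicates: classical_sets.set cannot be used there
   because fieldExtType rat is too large for its universe. *)
Definition iso_closed_fields (C : fieldExtType rat -> Prop) : Prop :=
  forall K L, field_iso K L -> C K -> C L.

Section NumberField.
Variable K : fieldExtType rat.

(* The Q-span of an arbitrary subset of K. *)
Definition vspan (A : set K) : {vspace K} :=
  xget 0%VS [set V : {vspace K} | A `<=` [set` V] /\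
    forall W : {vspace K}, A `<=` [set` W] -> (V <= W)%VS].

(* Since K is algebraic over Q, the subfield Q(A) generated by A is the
   subalgebra generated by the span of A. *)
Definition gen_field (A : set K) : {subfield K} := <<vspan A>>%AS.

Definition field_trace (x : K) : rat :=
  \sum_(i < \dim {:K}) coord (vbasis {:K}) i (x * (vbasis {:K})`_i).

(* [tower_type_of D T] says that the members of D are exactly the fields of a
   tower Q = K_0 < K_1 < ... < K_t without trivial extensions, and that
   T = ([K_1 : K_0], ..., [K_t : K_(t-1)]). *)
Definition tower_type_of (D : set {subfield K}) (T : seq nat) : Prop :=
  exists Ks : seq {subfield K},
    [/\ path (fun E F : {subfield K} => (E <= F)%VS && (E != F)) 1%AS Ks,
        [set` 1%AS :: Ks] = D
      & pairmap (fun E F : {subfield K} => \dim_E F) 1%AS Ks = T].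

Definition Zbasis (O : set K) (b : (\dim {:K}).-tuple K) : Prop :=
  basis_of {:K} b /\
  O = [set x | exists c : 'I_(\dim {:K}) -> int,
               x = \sum_(i < \dim {:K}) b`_i *~ c i].

Definition is_order (O : set K) : Prop :=
  [/\ exists b, Zbasis O b, O 1 & forall x y, O x -> O y -> O (x * y)].

(* Does not depend on the Z-basis chosen by xget. *)
Definition abs_disc (O : set K) : rat :=
  let b := xget (vbasis {:K}) [set b | Zbasis O b] in
  `|\det (\matrix_(i, j < \dim {:K}) field_trace (b`_i * b`_j))|.

Section Real.
Variable R : realType.

(* The sum over embeddings below is a finite-support sum over this finite set. *)
Definition embeddings : set (K -> R[i]) :=
  range (fun s : {rmorphism K -> R[i]} => s : K -> R[i]).

Definition embnorm (x : K) : R :=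
  Num.sqrt ((\dim {:K})%:R^-1 *
    \sum_(s \in embeddings) ComplexField.Normc.normc (s x) ^+ 2).

Definition short (O : set K) (r : R) : set K :=
  O `&` [set x | embnorm x <= r].

Definition minimum (A : set R) : R := xget 0 (A `&` lbound A).

Definition succ_min (O : set K) (i : nat) : R :=
  minimum [set r | 0 < r /\ (i.+1 <= \dim (vspan (short O r)))%N].

Definition order_tower_type (O : set K) (T : seq nat) : Prop :=
  tower_type_of [set gen_field (short O r) | r in [set r : R | 0 < r]] T.

End Real.

(* Flags in a field of degree d.+1. *)
Definition is_flag (d : nat) (F : 'I_d.+1 -> {vspace K}) : Prop :=
  [/\ F ord0 = 1%VS, F ord_max = {:K}%VS,
      forall i j : 'I_d.+1, (i <= j)%N -> (F i <= F j)%VS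
    & forall i, \dim (F i) = i.+1].

Definition flag_tower_type (d : nat) (F : 'I_d.+1 -> {vspace K})
    (T : seq nat) : Prop :=
  tower_type_of [set gen_field [set` F i] | i in [set: 'I_d.+1]] T.

(* U V := {u v : u in U, v in V} is contained in W. *)
Definition prod_sub (U V W : {vspace K}) : Prop :=
  forall u v, u \in U -> v \in V -> u * v \in W.

Definition flag_type (d : nat) (F : 'I_d.+1 -> {vspace K})
    (i j : 'I_d.+1) : 'I_d.+1 :=
  [arg min_(k < ord_max | `[< prod_sub (F i) (F j) (F k) >]) (k : nat)]%N.

End NumberField.

Record numorder : Type := NumOrder {
  ofield : fieldExtType rat;
  oset : set ofield;
  _ : is_order oset }.

Arguments oset : clear implicits.

(* Ring isomorphism between the orders themselves; the values of g outside
   oset O are irrelevant. *)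
Definition order_iso (O O' : numorder) : Prop :=
  exists g : ofield O -> ofield O',
    [/\ set_bij (oset O) (oset O') g, g 1 = 1,
        forall x y, oset O x -> oset O y -> g (x + y) = g x + g y
      & forall x y, oset O x -> oset O y -> g (x * y) = g x * g y].

Definition iso_closed_orders (S : numorder -> Prop) : Prop :=
  forall O O', order_iso O O' -> S O -> S O'.

Definition finitely_many_classes (S : numorder -> Prop) : Prop :=
  exists N (rep : 'I_N -> numorder),
    forall O, S O -> exists i, order_iso (rep i) O.

Section Spectrum.
Variables (R : realType) (d : nat).

(* The set S(T, K) of isomorphism classes. *)
Definition orders_of_type (T : seq nat) (K : fieldExtType rat) :
    numorder -> Prop :=
  fun O => exists A (hA : @is_order K A),
    order_tower_type R A T /\ order_iso (NumOrder hA) O.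

(* A point (x_1, ..., x_d) of R^d is a row vector with 0-based entries, so the
   entry j holds log_Delta lambda_(j+1). *)
Definition log_minima (O : numorder) : 'rV[R]_d :=
  \row_(j < d) (ln (succ_min R (oset O) j.+1) /
                ln (ratr (abs_disc (oset O)))).

(* For every e > 0, all but finitely many isomorphism classes in S are within e
   of x. *)
Definition minkowski_type (S : numorder -> Prop) (x : 'rV[R]_d) : Prop :=
  ~ finitely_many_classes S /\
  forall e : R, 0 < e ->
    finitely_many_classes (fun O => S O /\
      ~ (forall j, `|log_minima O 0 j - x 0 j| < e)).

Definition Spe (S : numorder -> Prop) : set 'rV[R]_d :=
  [set x | exists S', [/\ iso_closed_orders S', forall O, S' O -> S O
                        & minkowski_type S' x]].

(* row_mx 0 x shifts x to the 1-based indexing x_1, ..., x_d; the entry at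
   index 0 is never used when t is a flag type, as then t i j >= i >= 1. *)
Definition polytope (t : 'I_d.+1 -> 'I_d.+1 -> 'I_d.+1) : set 'rV[R]_d :=
  [set x | let y : 'rV[R]_(1 + d) := row_mx 0 x in
    [/\ \sum_j x 0 j = 1 / 2,
        forall j, 0 <= x 0 j,
        forall i j : 'I_d, (i <= j)%N -> x 0 i <= x 0 j
      & forall i j : 'I_d.+1, (0 < i)%N -> (0 < j)%N ->
          y 0 (t i j) <= y 0 i + y 0 j]].

End Spectrum.

(* Main.v *)
From HB Require Import structures.
Require Import Defs.
From mathcomp Require Import sequences perm ring lra zify.
Set Implicit Arguments.
Unset Strict Implicit.
Unset Printing Implicit Defensive.
Import Order.TTheory GRing.Theory Num.Theory.
Local Open Scope classical_set_scope.
Local Open Scope ring_scope.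

(* For an order O with successive minima lambda_i, let V(r) be the Q-span of the
   elements of O of norm at most r.  A product of elements of norms r and r' has
   norm at most sqrt n r r', so for a flag F with F_i inside V(lambda_i) and flag
   type T one has lambda_(T(i,j)) <= sqrt n lambda_i lambda_j; F can be chosen with
   the same tower of fields as O.  As lambda_1 ... lambda_(n-1) agrees with the
   square root of the discriminant up to constants, and only finitely many orders
   have bounded discriminant, the logarithms of the minima of an infinite family
   tend to a point of P_T, where T is a flag type that occurs infinitely often.

   Conversely, let b be a basis of K adapted to F, with b_0 = 1 and integral
   structure constants.  If x lies in P_(T_F), the integers a_i = ceil(l x_i),
   corrected by bounded amounts, satisfy a_(T(i,j)) <= a_i + a_j, so the elements
   2^(a_i) b_i span an order.  Its minima are 2^(a_i) up to constants, and when the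
   gaps a_(i+1) - a_i exceed a constant its short elements span exactly the spaces
   of F.  Let l tend to infinity. *)

(** * Reduction of positive definite integral forms *)

(** Every error is finally divided by the logarithm of the discriminant, so constants depending only
    on the degree may be crude. The product of the minima is bounded below by a determinant estimate
    with the factor [n!], and above by a basis reduced in the sense of Hermite, in place of
    Minkowski's second theorem. The fields of the class vary, so finiteness for bounded discriminant
    has to cover all fields of the given degree at once; bounding the multiplication table of a
    reduced basis settles fields and orders together. The passage to the limit involves no
    compactness: flag types are functions between finite sets, one of them serves for every error
    bound, and the witnessing field and flag are read off from a single order. Conversely, a point
    of the polytope may have equal or zero coordinates, whereas the tower type depends on exact
    spans of short elements. This is why the exponents receive gaps; these are independent of [l]
    and disappear after rescaling. *)

Section PositiveForms.
Variable R : realType.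

Definition bform n (A : 'M[R]_n) (x y : 'rV[R]_n) : R := (x *m A *m y^T) 0 0.

Definition posdef n (A : 'M[R]_n) : Prop :=
  A^T = A /\ forall x : 'rV[R]_n, x != 0 -> 0 < bform A x x.

Lemma bform_congr n m (A : 'M[R]_n) (M : 'M[R]_(m, n)) x y :
  bform (M *m A *m M^T) x y = bform A (x *m M) (y *m M).
Proof. by rewrite /bform trmx_mul !mulmxA. Qed.

Lemma bformC n (A : 'M[R]_n) x y : A^T = A -> bform A x y = bform A y x.
Proof.
move=> As; rewrite /bform -[LHS](mxE trmx_key (fun i j => (x *m A *m y^T) j i)).
by rewrite -/(trmx _) !trmx_mul trmxK As mulmxA.
Qed.

Lemma bformDl n (A : 'M[R]_n) x y z : bform A (x + y) z = bform A x z + bform A y z.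
Proof. by rewrite /bform !mulmxDl mxE. Qed.

Lemma bformDr n (A : 'M[R]_n) x y z : bform A z (x + y) = bform A z x + bform A z y.
Proof. by rewrite /bform linearD /= !mulmxDr mxE. Qed.

Lemma bformZl n (A : 'M[R]_n) a x z : bform A (a *: x) z = a * bform A x z.
Proof. by rewrite /bform -!scalemxAl mxE. Qed.

Lemma bformZr n (A : 'M[R]_n) a x z : bform A z (a *: x) = a * bform A z x.
Proof. by rewrite /bform linearZ /= -!scalemxAr mxE. Qed.

Lemma posdef_ge0 n (A : 'M[R]_n) x : posdef A -> 0 <= bform A x x.
Proof.
case=> _ Ap; have [->|/Ap/ltW//] := eqVneq x 0.
by rewrite /bform !mul0mx mxE.
Qed.

Lemma posdef_unit n (A : 'M[R]_n) : posdef A -> A \in unitmx.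
Proof.
case=> _ Ap; rewrite -row_free_unit -kermx_eq0; apply/rowV0P => v.
move/sub_kermxP => vA; apply/eqP/negPn/negP => /Ap.
by rewrite /bform vA mul0mx mxE ltxx.
Qed.

Lemma posdef_CS n (A : 'M[R]_n) x y :
  posdef A -> bform A x y ^+ 2 <= bform A x x * bform A y y.
Proof.
move=> Ap; have As := Ap.1; have [->|y0] := eqVneq y 0.
  by rewrite /bform linear0 !mulmx0 !mxE expr0n mulr0.
have yp := Ap.2 _ y0.
(* Positivity at [A(y,y) x - A(x,y) y] is [A(y,y)] times the claimed inequality. *)
have := posdef_ge0 (bform A y y *: x + (- bform A x y) *: y) Ap.
rewrite !(bformDl, bformDr, bformZl, bformZr) (bformC y x As).
move: (bform A x y) (bform A x x) (bform A y y) yp => b a c c0 H.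
have {}H : 0 <= c * (a * c - b ^+ 2) by move: H; congr (_ <= _); ring.
by move: H; rewrite pmulr_rge0 // subr_ge0.
Qed.

(** The coordinate is the product of [x] with the dual vector [e_i A^-1], whose own value is the
    diagonal entry of the inverse; Cauchy-Schwarz then applies. The finiteness results and
    coordinate estimates below rest on this bound. *)
Lemma posdef_coord_le n (A : 'M[R]_n) (x : 'rV[R]_n) i : posdef A ->
  x 0 i ^+ 2 <= bform A x x * invmx A i i.
Proof.
move=> Ap; pose y : 'rV[R]_n := delta_mx 0 i *m invmx A.
have uA := posdef_unit Ap; have As := Ap.1.
have iS : (invmx A)^T = invmx A by rewrite trmx_inv As.
have -> : x 0 i = bform A x y.
  by rewrite /bform trmx_mul iS -mulmxA mulKVmx // trmx_delta -colE mxE.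
have -> : invmx A i i = bform A y y.
  rewrite /bform trmx_mul iS -mulmxA mulKVmx // trmx_delta.
  by rewrite -colE mxE /y -rowE mxE.
exact: posdef_CS.
Qed.

Definition realmx n m (c : 'M[int]_(n, m)) : 'M[R]_(n, m) := map_mx intr c.

Lemma finite_int_box n (N : R) :
  finite_set [set c : 'rV[int]_n | forall i, `|(c 0 i)%:~R| <= N :> R].
Proof.
pose M := Num.truncn `|N|.
pose f (t : {ffun 'I_n -> 'I_(M.*2.+1)}) : 'rV[int]_n := \row_i ((t i : nat)%:Z - M%:Z).
apply: (@sub_finite_set _ _ (range f)); last exact: finite_image.
move=> c cN; have H i : (`|c 0 i| <= M%:Z)%R.
  have: `|(c 0 i)%:~R| <= `|N| := le_trans (cN i) (ler_norm _).
  rewrite -intr_norm.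
  have -> : `|c 0 i|%R = (absz (c 0 i))%:Z by rewrite abszE.
  rewrite lez_nat => h. rewrite /M -(@natrK R (absz (c 0 i))).
  by apply: Num.Theory.le_truncn; rewrite -pmulrn in h.
exists [ffun i => inord (absz (c 0 i + M%:Z))] => //.
apply/rowP => i; rewrite mxE ffunE inordK.
  have := H i; lia.
have := H i; lia.
Qed.

Lemma finite_min (T : choiceType) (S : set T) (f : T -> R) x0 :
  finite_set S -> S x0 -> exists2 x, S x & forall y, S y -> f x <= f y.
Proof.
case/finite_seqP => s -> /= x0s.
suff [x xs xP] : exists2 x, x \in s & forall y, y \in s -> f x <= f y by exists x.
elim: s x0 x0s => // a s IH x0 _.
have [->|[b bs]] : s = [::] \/ exists b, b \in s.
- by case: s {IH} => [|b s]; [left|right; exists b; rewrite mem_head].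
- by exists a; rewrite ?mem_head // => y; rewrite inE => /eqP ->.
have [x xs xP] := IH b bs.
have [ax|xa] := leP (f a) (f x).
  exists a; rewrite ?mem_head // => y; rewrite inE => /orP[/eqP -> //|/xP].
  exact: le_trans.
exists x; first by rewrite inE xs orbT.
by move=> y; rewrite inE => /orP[/eqP -> |/xP //]; apply: ltW.
Qed.

Lemma posdef_finite n (A : 'M[R]_n) (r : R) : posdef A ->
  finite_set [set c : 'rV[int]_n | bform A (realmx c) (realmx c) <= r].
Proof.
move=> Ap; pose B := `|r| * \sum_i `|invmx A i i|.
apply: sub_finite_set (finite_int_box n (1 + B)) => c /= cr i.
have B0 : 0 <= B by rewrite mulr_ge0 // sumr_ge0.
have : `|(c 0 i)%:~R| ^+ 2 <= B.
  have := posdef_coord_le (realmx c) i Ap; rewrite mxE -normrX ger0_norm ?sqr_ge0 //.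
  move=> /le_trans -> //; apply: (le_trans (ler_norm _)); rewrite normrM.
  apply: ler_pM => //.
    by rewrite ger0_norm ?posdef_ge0 // (le_trans cr) // ler_norm.
  by rewrite (bigD1 i) //= lerDl sumr_ge0.
(* In place of a square root: [z ^+ 2 <= B] forces [z <= 1 + B]. *)
move: (normr_ge0 (c 0 i)%:~R : 0 <= _ :> R); move: `|_| => z z0 zB.
by rewrite leNgt; apply/negP => h; nra.
Qed.

(** Only finitely many integer vectors have a value at most that of the all-ones vector, so the
    minimum is attained. *)
Lemma posdef_minvec n (A : 'M[R]_n) : posdef A -> (0 < n)%N ->
  exists2 v : 'rV[int]_n, v != 0 & forall w : 'rV[int]_n, w != 0 ->
    bform A (realmx v) (realmx v) <= bform A (realmx w) (realmx w).
Proof.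
move=> Ap n0; pose v0 : 'rV[int]_n := const_mx 1.
have v00 : v0 != 0.
  by apply/eqP => /matrixP /(_ 0 (Ordinal n0)); rewrite !mxE.
pose q (c : 'rV[int]_n) := bform A (realmx c) (realmx c).
have Sf : finite_set [set c | c != 0 /\ q c <= q v0].
  by apply: sub_finite_set (posdef_finite (q v0) Ap) => c [].
have [|x [x0 xv] xP] := finite_min q (x0 := v0) Sf; first by split.
exists x => // w w0; have [wv|/ltW vw] := leP (q w) (q v0).
  exact: xP.
exact: le_trans vw.
Qed.

Lemma unimodular_min n (A : 'M[R]_n.+1) : posdef A ->
  exists2 U : 'M[int]_n.+1, U \in unitmx & forall w : 'rV[int]_n.+1, w != 0 ->
    bform A (realmx (row 0 U)) (realmx (row 0 U)) <= bform A (realmx w) (realmx w).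
Proof.
move=> Ap; have [v v0 vP] := posdef_minvec Ap isT.
(* For a single row the Smith form reads [v = L D U] with [L] of size one, so [v] is a nonzero
   integer multiple of the first row of [U], which is therefore no longer than [v]. *)
have [L uL [U uU [d _ dE]]] := int_Smith_normal_form v.
exists U => //.
have [e vE] : exists e : int, v = e *: row 0 U.
  exists (L 0 0 * d`_0); rewrite dE -mulmxA [L]mx11_scalar mul_scalar_mx -scalerA mxE.
  congr (_ *: _).
  apply/rowP => j; rewrite !mxE (bigD1 0) //= big1 ?addr0 ?mxE ?mulr1n //.
  move=> i i0; rewrite !mxE; case: (eqVneq (0%N) i) => [i0'|_]; last by rewrite mulr0n mul0r.
  by case/eqP: i0; apply: val_inj.
have e0 : e != 0 by apply: contraNneq v0 => e0; rewrite vE e0 scale0r.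
move=> w w0; apply: le_trans (vP w w0).
have -> : realmx v = e%:~R *: realmx (row 0 U).
  by rewrite vE; apply/rowP => j; rewrite !mxE rmorphM.
rewrite bformZl bformZr mulrA ler_peMl ?posdef_ge0 //.
rewrite -rmorphM /= -[1]/((1 : int)%:~R) ler_int; lia.
Qed.

(** The Schur complement of the corner entry: the form on projections orthogonal to the first basis
    vector. *)
Definition schur n (A : 'M[R]_(1 + n)) : 'M[R]_n :=
  drsubmx A - (A 0 0)^-1 *: ((ursubmx A)^T *m ursubmx A).

(** Completing the square in the first coordinate. *)
Lemma bform_block n (A : 'M[R]_(1 + n)) (k : 'rV[R]_1) (u : 'rV[R]_n) :
  A^T = A -> A 0 0 != 0 ->
  bform A (row_mx k u) (row_mx k u) =
  A 0 0 * (k 0 0 + (u *m (ursubmx A)^T) 0 0 / A 0 0) ^+ 2 + bform (schur A) u u.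
Proof.
move=> As a0; rewrite /bform /schur -{1}[A]submxK.
have -> : dlsubmx A = (ursubmx A)^T by rewrite trmx_ursub As.
have -> : ulsubmx A = (A 0 0)%:M.
  by rewrite [LHS]mx11_scalar; congr (_ %:M); rewrite !mxE; congr (A _ _); apply: val_inj.
move: (A 0 0) a0 (ursubmx A) (drsubmx A) => a a0 c D.
rewrite mul_row_block tr_row_mx mul_row_col mulmxBr mulmxBl.
rewrite -!scalemxAr -!scalemxAl !mulmxDl.
set t := u *m c^T.
have -> : u *m (c^T *m c) *m u^T = t *m t^T.
  by rewrite /t !trmx_mul trmxK !mulmxA.
have -> : k *m c *m u^T = k *m t^T by rewrite /t trmx_mul trmxK mulmxA.
rewrite [k]mx11_scalar [t]mx11_scalar.
move: (k 0 0) (t 0 0) (u *m D *m u^T) => k' t' w.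
rewrite !tr_scalar_mx -!scalar_mxM !mxE !eqxx !mulr1n.
by field.
Qed.

Lemma det_schur n (A : 'M[R]_(1 + n)) :
  A^T = A -> A 0 0 != 0 -> \det A = A 0 0 * \det (schur A).
Proof.
move=> As a0; rewrite /schur -{1}[A]submxK.
have -> : dlsubmx A = (ursubmx A)^T by rewrite trmx_ursub As.
have -> : ulsubmx A = (A 0 0)%:M.
  by rewrite [LHS]mx11_scalar; congr (_ %:M); rewrite !mxE; congr (A _ _); apply: val_inj.
move: (A 0 0) a0 (ursubmx A) (drsubmx A) => a a0 c D.
set S := D - _.
have -> : block_mx a%:M c c^T D = block_mx 1%:M 0 (a^-1 *: c^T) 1%:M *m block_mx a%:M c 0 S.
  rewrite mulmx_block !mul0mx !mulmx0 !mul1mx !addr0 ?add0r -scalemxAl mul_mx_scalar.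
  by rewrite scalerA mulVf // scale1r -scalemxAl /S addrC subrK.
by rewrite det_mulmx det_lblock det_ublock !det1 det_scalar1 !mul1r.
Qed.

Lemma posdef_congr n (A M : 'M[R]_n) :
  posdef A -> M \in unitmx -> posdef (M *m A *m M^T).
Proof.
move=> [As Ap] Mu; split; first by rewrite !trmx_mul trmxK As mulmxA.
move=> x x0; rewrite bform_congr; apply: Ap; apply: contraNneq x0 => xM.
by rewrite -(mulmxK Mu x) xM mul0mx.
Qed.

Lemma posdef_diag n (A : 'M[R]_n) i : posdef A -> 0 < A i i.
Proof.
move=> Ap; have -> : A i i = bform A (delta_mx 0 i) (delta_mx 0 i).
  by rewrite /bform trmx_delta -rowE -colE !mxE.
apply: Ap.2; apply/eqP => /matrixP /(_ 0 i); rewrite !mxE !eqxx.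
by move/eqP; rewrite oner_eq0.
Qed.

Lemma posdef_schur n (A : 'M[R]_(1 + n)) : posdef A -> posdef (schur A).
Proof.
move=> Ap; have a0 : A 0 0 != 0 by rewrite gt_eqF // posdef_diag.
split.
  rewrite /schur linearB linearZ /= trmx_mul trmxK; congr (_ - _).
  by rewrite trmx_drsub Ap.1.
move=> u u0.
(* The first coordinate that annihilates the square in [bform_block] and leaves the Schur form
   alone. *)
pose t : 'rV[R]_1 := (- ((u *m (ursubmx A)^T) 0 0 / A 0 0))%:M.
have := Ap.2 (row_mx t u); rewrite bform_block ?Ap.1 //.
rewrite [t 0 0]mxE eqxx mulr1n addNr expr0n mulr0 add0r; apply.
by apply: contraNneq u0 => /eqP; rewrite row_mx_eq0 => /andP[_ /eqP ->].
Qed.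

Lemma int_unit_sqr (x : int) : x \is a GRing.unit -> x ^+ 2 = 1.
Proof.
case/unitrP => y [_ xy]; have : (absz x * absz y)%N = 1%N by rewrite -abszM xy.
by move/eqP; rewrite muln_eq1 => /andP[/eqP x1 _]; lia.
Qed.

Lemma row_unitmx_neq0 n (U : 'M[int]_n) i : U \in unitmx -> row i U != 0.
Proof.
move=> uU; apply/eqP => U0; have := mulmxV uU; move/(congr1 (row i)).
rewrite row_mul U0 mul0mx => /matrixP /(_ 0 i); rewrite !mxE eqxx.
by move/eqP; rewrite eq_sym oner_eq0.
Qed.

(* Hermite's induction: a minimal vector is completed to a unimodular matrix by the
   Smith normal form, the Schur complement is reduced, and the lifted rows are
   corrected by multiples of the minimal vector; by minimality each of them is then
   at most 4/3 as long (in squared norm) as its projection. *)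
Lemma hermite_reduction n : exists2 C : R, 0 < C &
  forall A : 'M[R]_n, posdef A -> exists2 U : 'M[int]_n, U \in unitmx &
    \prod_i bform A (realmx (row i U)) (realmx (row i U)) <= C * \det A.
Proof.
elim: n => [|n [C C0 IH]].
  exists 1 => // A _; exists 1%:M; first exact: unitmx1.
  by rewrite big_ord0 det_mx00 mulr1.
exists ((4 / 3) ^+ n * C); first by rewrite mulr_gt0 // exprn_gt0 // divr_gt0.
move=> A Ap; have [U0 uU0 U0P] := unimodular_min Ap.
have uU0R : realmx U0 \in unitmx by rewrite unitmxE det_map_mx rmorph_unit // -unitmxE.
pose B : 'M[R]_(1 + n) := realmx U0 *m A *m (realmx U0)^T.
have Bp : posdef B by apply: posdef_congr.
have b0 := posdef_diag (0 : 'I_(1 + n)) Bp.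
have [V uV VP] := IH _ (posdef_schur Bp).
have bE (w : 'rV[int]_n.+1) : bform B (realmx w) (realmx w) = bform A (realmx (w *m U0)) (realmx (w *m U0)).
  by rewrite bform_congr -map_mxM.
have bmin (w : 'rV[int]_n.+1) : w != 0 -> B 0 0 <= bform B (realmx w) (realmx w).
  move=> w0; have -> : B 0 0 = bform A (realmx (row 0 U0)) (realmx (row 0 U0)).
    have -> : B 0 0 = bform B (delta_mx 0 0) (delta_mx 0 0).
      by rewrite /bform trmx_delta -rowE -colE !mxE.
    rewrite bform_congr; congr bform; rewrite -rowE /realmx map_row //.
  rewrite bE; apply: U0P; apply: contraNneq w0 => h.
  by rewrite -(mulmxK uU0 w) h mul0mx.
pose t i : R := (realmx (row i V) *m (ursubmx B)^T) 0 0 / B 0 0.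
(* Rounding [t i] to the nearest integer leaves a first component of at most 1/2. With [b] the
   minimum and [s] the Schur value of the row, minimality says [b <= b / 4 + s], so [b <= 4 s / 3],
   and the lifted row has value at most [b / 4 + s <= 4 s / 3]. *)
pose k : 'cV[int]_n := \col_i - Num.floor (t i + 1 / 2).
pose W : 'M[int]_(1 + n) := block_mx 1%:M 0 k V.
have uW : W \in unitmx by rewrite unitmxE det_lblock det1 mul1r -unitmxE.
exists (W *m U0); first by rewrite unitmx_mul uW uU0.
have -> : \det A = \det B.
  rewrite /B !det_mulmx det_tr mulrAC -expr2 det_map_mx -rmorphXn /=.
  by rewrite int_unit_sqr ?mul1r // -unitmxE.
rewrite (det_schur Bp.1) ?gt_eqF //.
under eq_bigr do rewrite row_mul -bE.
rewrite (@big_split_ord _ _ _ 1 n) big_ord1 /=.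
have -> : row (lshift n 0) W = row_mx 1%:M 0.
  rewrite /W /block_mx rowKu row_row_mx; congr row_mx; last exact: row0.
  by apply/matrixP => a b; rewrite !mxE !ord1.
have -> : realmx (row_mx 1%:M 0) = row_mx 1%:M 0 :> 'rV[R]_(1 + n).
  by rewrite /realmx map_row_mx map_mx0 map_mx1.
have -> : bform B (row_mx 1%:M 0) (row_mx 1%:M 0) = B 0 0.
  rewrite bform_block ?Bp.1 ?gt_eqF // mul0mx /bform !mul0mx [X in X / _]mxE mul0r addr0.
  by rewrite [X in _ + X]mxE addr0 [1%:M _ _]mxE expr1n mulr1.
rewrite mulrCA ler_pM2l //.
have -> : (4 / 3) ^+ n * C * \det (schur B) = (4 / 3) ^+ n * (C * \det (schur B)) :> R.
  by rewrite mulrA.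
apply: (@le_trans _ _ ((4 / 3) ^+ n *
    \prod_i bform (schur B) (realmx (row i V)) (realmx (row i V)))); last first.
  by rewrite ler_pM2l // exprn_gt0 // divr_gt0.
rewrite -[n in X in _ <= X * _]card_ord -prodr_const -big_split /=.
apply: ler_prod => i _; rewrite posdef_ge0 //=.
have := bmin _ (row_unitmx_neq0 (rshift 1 i) uW).
have -> : realmx (row (rshift 1 i) W) = row_mx (realmx (row i k)) (realmx (row i V)).
  by rewrite /W /block_mx rowKd row_row_mx /realmx map_row_mx.
rewrite bform_block ?Bp.1 ?gt_eqF //.
have -> : realmx (row i k) 0 0 = - (Num.floor (t i + 1 / 2))%:~R.
  by rewrite !mxE rmorphN.
rewrite -/(t i).
have := floor_le (t i + 1 / 2); have := floorD1_gt (t i + 1 / 2).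
rewrite intrD; pose f : R := (Num.floor (t i + 1 / 2))%:~R; rewrite -/f.
move: f (t i) (bform (schur B) _ _) => f t' s; move: (B 0 0) b0 => b b0 h1 h2 h3.
have h4 : (- f + t') ^+ 2 <= 1 / 4 by nra.
have : b * (- f + t') ^+ 2 <= b * (1 / 4) by rewrite ler_pM2l.
by move: h3; lra.
Qed.

End PositiveForms.

(** * Bases and complex embeddings *)

Section Bases.
Variable K : fieldExtType rat.

(** Bases are functions on ['I_n], with [n = \dim {:K}] only a propositional equality, so that [n]
    can be [d.+1] uniformly in all fields. *)
Definition is_basis n (b : 'I_n -> K) := basis_of {:K} [tuple b i | i < n].
Definition qcoord n (b : 'I_n -> K) (i : 'I_n) (x : K) : rat :=
  coord [tuple b i | i < n] i x.

Lemma mktuple_nth n (b : 'I_n -> K) (i : 'I_n) : [tuple b i | i < n]`_i = b i.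
Proof. by rewrite -tnth_nth tnth_mktuple. Qed.

Lemma is_basis_sum n (b : 'I_n -> K) x : is_basis b -> x = \sum_i qcoord b i x *: b i.
Proof.
move=> bb; rewrite {1}(coord_basis bb (memvf x)).
by apply: eq_bigr => i _; rewrite mktuple_nth.
Qed.

Lemma qcoord_sum n (b : 'I_n -> K) k j :
  is_basis b -> qcoord b j (\sum_i k i *: b i) = k j.
Proof.
move=> bb; rewrite -(coord_sum_free k j (basis_free bb)).
by congr coord; apply: eq_bigr => i _; rewrite mktuple_nth.
Qed.

Lemma is_basis_dim n (b : 'I_n -> K) : is_basis b -> n = \dim {:K}.
Proof. by move/size_basis. Qed.

Lemma is_basis_span n (b : 'I_n -> K) : n = \dim {:K} ->
  (forall x, exists k, x = \sum_i k i *: b i) -> is_basis b.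
Proof.
move=> nK bP; rewrite /is_basis basisEdim size_tuple -nK leqnn andbT.
apply/subvP => x _; have [k ->] := bP x; apply: memv_suml => i _; apply: memvZ.
by apply: memv_span; rewrite -(mktuple_nth b) mem_nth ?size_tuple.
Qed.

Lemma qcoord_lin n (b : 'I_n -> K) i a x y :
  qcoord b i (a *: x + y) = a * qcoord b i x + qcoord b i y.
Proof. by rewrite /qcoord linearP. Qed.

Lemma qcoord_delta n (b : 'I_n -> K) i j : is_basis b -> qcoord b i (b j) = (j == i)%:R.
Proof.
by move=> bb; rewrite /qcoord -(mktuple_nth b j) coord_free ?(basis_free bb).
Qed.

End Bases.

Section Embeddings.
Variables (K : fieldExtType rat) (R : realType).
Local Notation C := (R[i]).

Definition embedding_enum n (s : 'I_n -> {rmorphism K -> C}) :=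
  injective (fun m => s m : K -> C) /\
  forall e : {rmorphism K -> C}, exists m, (e : K -> C) = s m.

Lemma pchar_number_field : [pchar K] =i pred0.
Proof.
by move=> p; rewrite pchar_lalg pchar_num.
Qed.

Lemma primitive_element : exists t : K, <<1; t>>%VS = {:K}%VS.
Proof.
exists (separable_generator 1 {:K}).
rewrite -eq_adjoin_separable_generator ?sub1v //.
by apply/separableP => x _; apply: pcharf0_separable; exact: pchar_number_field.
Qed.

Lemma emb_scale (e : {rmorphism K -> C}) (a : rat) x : e (a *: x) = ratr a * e x.
Proof.
rewrite -mulr_algl rmorphM; congr (_ * _).
exact: (fmorph_eq_rat (e \o in_alg K)).
Qed.

Lemma emb_horner (e : {rmorphism K -> C}) (q : {poly rat}) t :
  e (map_poly (in_alg K) q).[t] = (map_poly ratr q).[e t].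
Proof.
rewrite -horner_map -map_poly_comp; congr (_.[_]); apply: eq_map_poly => a /=.
by rewrite emb_scale rmorph1 mulr1.
Qed.

(** Send a polynomial in [t] to the same polynomial in [z]. The choice of polynomial is immaterial:
    two choices differ by a multiple of the minimal polynomial, which vanishes at [z]. *)
Lemma embedding_of_root (t : K) (p : {poly rat}) (z : C) :
  <<1; t>>%VS = {:K}%VS -> minPoly 1 t = map_poly (in_alg K) p ->
  root (map_poly ratr p) z -> exists e : {rmorphism K -> C}, e t = z.
Proof.
move=> tK pE zp.
have qP x : exists q : {poly rat}, x = (map_poly (in_alg K) q).[t].
  have /Fadjoin_polyP[q /polyOver1P[q' ->] ->] : x \in <<1; t>>%VS by rewrite tK memvf.
  by exists q'.
pose q x := projT1 (cid (qP x)).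
have qE x : x = (map_poly (in_alg K) (q x)).[t] by rewrite /q; case: cid.
pose f x := (map_poly ratr (q x)).[z].
have fP r x : x = (map_poly (in_alg K) r).[t] -> f x = (map_poly ratr r).[z].
  move=> xr; apply/eqP; rewrite -subr_eq0 -hornerN -hornerD -rmorphB /=.
  have : minPoly 1 t %| map_poly (in_alg K) (q x - r).
    apply: minPoly_dvdp; first by apply/polyOver1P; exists (q x - r).
    by rewrite /root rmorphB hornerD hornerN -qE -xr subrr.
  rewrite pE dvdp_map => /dvdpP[u ->].
  by rewrite rmorphM hornerM (eqP zp) mulr0.
have fa : zmod_morphism f.
  move=> x y; rewrite (fP (q x - q y)) ?rmorphB ?hornerD ?hornerN //.
  by rewrite -!qE.
have fm : monoid_morphism f.
  split; first by rewrite (fP 1) ?rmorph1 ?hornerC.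
  move=> x y; rewrite (fP (q x * q y)) ?rmorphM ?hornerM //.
  by rewrite -!qE.
pose fA := GRing.isZmodMorphism.Build K C f fa.
pose fM := GRing.isMonoidMorphism.Build K C f fm.
pose F : {rmorphism K -> C} := HB.pack f fA fM.
by exists F; rewrite /F /= (fP 'X) ?map_polyX ?hornerX.
Qed.

(** Embeddings correspond to the roots of the minimal polynomial of a primitive element; by
    separability, and as [R[i]] is algebraically closed, there are as many as the degree. *)
Lemma embedding_enum_exists :
  exists s : 'I_(\dim {:K}) -> {rmorphism K -> C}, embedding_enum s.
Proof.
have [t tK] := primitive_element.
have /polyOver1P[p pE] := minPolyOver 1 t.
have sp : size p = (\dim {:K}).+1.
  rewrite -(size_map_poly (in_alg K)) -pE size_minPoly adjoin_degreeE tK dim_vline.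
  by rewrite oner_neq0 divn1.
have sepp : separable_poly p.
  have : separable_element 1 t by apply: pcharf0_separable; exact: pchar_number_field.
  by rewrite /separable_element pE separable_map.
have [rs rsE] := closed_field_poly_normal (map_poly (ratr : rat -> C) p).
have lp : lead_coef (map_poly (ratr : rat -> C) p) = 1.
  have : minPoly 1 t \is monic by exact: monic_minPoly.
  by rewrite pE map_monic => /monicP h; rewrite lead_coef_map h rmorph1.
rewrite lp scale1r in rsE.
have urs : uniq rs by rewrite -separable_prod_XsubC -rsE separable_map.
have srs : size rs = \dim {:K}.
  by apply: succn_inj; rewrite -sp -(size_map_poly (ratr : {rmorphism rat -> C})) rsE size_prod_XsubC.
have rootrs z : root (map_poly ratr p) z = (z \in rs) by rewrite rsE root_prod_XsubC.
have sP (m : 'I_(\dim {:K})) : exists e : {rmorphism K -> C}, e t = rs`_m.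
  by apply: (embedding_of_root tK pE); rewrite rootrs mem_nth // srs.
pose s m := projT1 (cid (sP m)).
have sE m : s m t = rs`_m by rewrite /s; case: cid.
exists s; split.
  move=> m m' /(congr1 (fun f => f t)); rewrite !sE => /eqP.
  by rewrite nth_uniq ?srs // => /eqP; apply: val_inj.
move=> e; have : root (map_poly ratr p) (e t).
  rewrite /root -emb_horner -pE minPolyxx rmorph0 //.
rewrite rootrs => /(nthP 0)[m ms em]; rewrite srs in ms.
exists (Ordinal ms); apply/funext => x.
have /Fadjoin_polyP[q /polyOver1P[q' ->] ->] : x \in <<1; t>>%VS by rewrite tK memvf.
by rewrite !emb_horner sE -em.
Qed.

End Embeddings.

(** * The inner product on a number field *)

(** A weak Hadamard inequality: by Cauchy-Schwarz on the entries each Leibniz term is at most the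
    product of the diagonal, and there are [n!] terms. *)
Lemma posdef_det_le (R : realType) n (A : 'M[R]_n) :
  posdef A -> \det A <= n`!%:R * \prod_i A i i.
Proof.
move=> Ap.
have Aii i : 0 <= A i i := ltW (posdef_diag i Ap).
have Aij i j : `|A i j| <= Num.sqrt (A i i) * Num.sqrt (A j j).
  rewrite -sqrtrM // -[`|A i j|]sqrtr_sqr; apply: ler_wsqrtr.
  have := posdef_CS (delta_mx 0 i) (delta_mx 0 j) Ap.
  by rewrite /bform !trmx_delta -!rowE -!colE !mxE.
apply: le_trans (ler_norm _) _; apply: le_trans (ler_norm_sum _ _ _) _.
have -> : n`!%:R * \prod_i A i i = \sum_(s : 'S_n) \prod_i A i i.
  by rewrite sumr_const card_Sn mulr_natl.
apply: ler_sum => s _; rewrite normrM normrX normrN1 expr1n mul1r normr_prod.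
apply: (le_trans (y := \prod_i (Num.sqrt (A i i) * Num.sqrt (A (s i) (s i))))).
  by apply: ler_prod => i _; rewrite normr_ge0 Aij.
rewrite big_split /= [X in _ * X](_ : _ = \prod_i Num.sqrt (A i i)); last first.
  by rewrite [RHS](reindex_inj (@perm_inj _ s)).
rewrite -big_split /= le_eqVlt; apply/orP; left; apply/eqP; apply: eq_bigr => i _.
by rewrite -expr2 sqr_sqrtr.
Qed.

Lemma field_trace_vbasis (K : fieldExtType rat) n (x : K) : n = \dim {:K} ->
  exists2 b : 'I_n -> K, is_basis b & field_trace x = \sum_i qcoord b i (x * b i).
Proof.
move=> ->; exists (fun i => (vbasis {:K})`_i).
  rewrite /is_basis [mktuple _](_ : _ = vbasis {:K}) ?vbasisP //.
  by apply: eq_from_tnth => i; rewrite tnth_mktuple -tnth_nth.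
apply: eq_bigr => i _; rewrite /qcoord; congr coord.
by apply: eq_from_tnth => j; rewrite tnth_mktuple -tnth_nth.
Qed.

Section Geometry.
Local Open Scope complex_scope.
Variables (K : fieldExtType rat) (R : realType) (n : nat).
Hypothesis nK : n = \dim {:K}.
Local Notation C := (R[i]).
Variable s : 'I_n -> {rmorphism K -> C}.
Hypothesis sP : embedding_enum s.
Implicit Types (b : 'I_n -> K) (x y : K).

Definition embmx b : 'M[C]_n := \matrix_(i, m) s m (b i).

(** The powers of a primitive element have as embedding matrix a Vandermonde matrix with distinct
    nodes, and this matrix factors through [embmx b]. *)
Lemma embmx_unit b : is_basis b -> embmx b \in unitmx.
Proof.
move=> bb; have [t tK] := primitive_element K.
have st m m' : s m t = s m' t -> m = m'.
  move=> mm; apply: sP.1; apply/funext => x /=.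
  have /Fadjoin_polyP[q /polyOver1P[q' ->] ->] : x \in <<1; t>>%VS by rewrite tK memvf.
  by rewrite !emb_horner mm.
pose P := Vandermonde n (\row_m s m t).
pose M : 'M[C]_n := \matrix_(i, j) ratr (qcoord b j (t ^+ i)).
have : M *m embmx b \in unitmx.
  have -> : M *m embmx b = P.
    apply/matrixP => i m; rewrite !mxE -rmorphXn {1}(is_basis_sum (t ^+ i) bb) rmorph_sum.
    by apply: eq_bigr => j _; rewrite !mxE emb_scale.
  rewrite unitmxE unitfE det_Vandermonde; apply/prodf_neq0 => i _.
  apply/prodf_neq0 => j ij; rewrite !mxE subr_eq0; apply: contraTneq ij => /st ->.
  by rewrite ltnn.
by rewrite unitmx_mul => /andP[].
Qed.

Definition mulmat b x : 'M[rat]_n := \matrix_(i, j) qcoord b j (x * b i).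

(** The columns of [embmx b] are common eigenvectors of all multiplications, with eigenvalues
    [s m x]; trace and norm are then read off from the diagonal. *)
Lemma mulmat_embmx b x : is_basis b ->
  map_mx ratr (mulmat b x) *m embmx b = embmx b *m diag_mx (\row_m s m x).
Proof.
move=> bb; apply/matrixP => i m; rewrite mul_mx_diag !mxE -rmorphM mulrC.
rewrite [in RHS](is_basis_sum (x * b i) bb) rmorph_sum.
by apply: eq_bigr => j _; rewrite !mxE emb_scale.
Qed.

Lemma mulmat_conj b x : is_basis b ->
  map_mx ratr (mulmat b x) = embmx b *m diag_mx (\row_m s m x) *m invmx (embmx b).
Proof. by move=> bb; rewrite -mulmat_embmx // mulmxK // embmx_unit. Qed.

Lemma trace_mulmat b x : is_basis b -> ratr (\tr (mulmat b x)) = \sum_m s m x.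
Proof.
move=> bb; rewrite -(trace_map_mx (ratr : {rmorphism rat -> C})) mulmat_conj //.
rewrite mxtrace_mulC mulKmx ?embmx_unit // mxtrace_diag.
by apply: eq_bigr => i _; rewrite mxE.
Qed.

Lemma det_mulmat b x : is_basis b -> ratr (\det (mulmat b x)) = \prod_m s m x.
Proof.
move=> bb; rewrite -(det_map_mx (ratr : {rmorphism rat -> C})) mulmat_conj //.
rewrite !det_mulmx mulrAC -det_mulmx mulmxV ?embmx_unit // det1 mul1r det_diag.
by apply: eq_bigr => i _; rewrite mxE.
Qed.

Definition RtoC : R -> C := real_complex R.

Lemma RtoCE : RtoC =1 real_complex R. Proof. by []. Qed.

Lemma ratr_complex (q : rat) : RtoC (ratr q) = ratr q.
Proof. exact: (fmorph_eq_rat (real_complex R \o (ratr : {rmorphism rat -> R}))). Qed.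

(* The sum is real, as conjugation permutes the embeddings: see [embdot_complex]. *)
Definition embdot x y : R := n%:R^-1 * complex.Re (\sum_m s m x * (s m y)^*).

Lemma sum_embeddings_conj (f : (K -> C) -> C) :
  \sum_m f (s m) = \sum_m f (fun x => (s m x)^*).
Proof.
have tP m : exists m', s m' = (fun x => (s m x)^*) :> (K -> C).
  pose e : {rmorphism K -> C} := (@conjc R) \o s m.
  by have [m' em'] := sP.2 e; exists m'; rewrite -em'.
pose t m := projT1 (cid (tP m)).
have tE m : s (t m) = (fun x => (s m x)^*) :> (K -> C) by rewrite /t; case: cid.
rewrite (reindex_inj (h := t)); first by apply: eq_bigr => m _; rewrite tE.
move=> m m' tm; apply: sP.1; apply/funext => x; apply: (can_inj (@conjcK R)).
by have := congr1 (fun f => f x) (tE m); rewrite tm tE /= => ->.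
Qed.

Lemma embdot_complex x y : RtoC (embdot x y) = n%:R^-1 * \sum_m s m x * (s m y)^*.
Proof.
rewrite /embdot; set z := \sum_m _.
have zc : z^* = z.
  rewrite {2}/z (sum_embeddings_conj (fun f => f x * (f y)^*)) /z rmorph_sum.
  by apply: eq_bigr => m _; rewrite rmorphM.
have zR : z = (complex.Re z)%:C.
  by case: z zc => a c [/eqP]; rewrite eq_sym -addr_eq0 -mulr2n mulrn_eq0 /= => /eqP ->.
by rewrite /RtoC rmorphM fmorphV rmorph_nat [in RHS]zR.
Qed.

Definition gram b : 'M[R]_n := \matrix_(i, j) embdot (b i) (b j).

Lemma gram_complex b :
  map_mx RtoC (gram b) = n%:R^-1 *: (embmx b *m (map_mx (@conjc R) (embmx b))^T).
Proof.
apply/matrixP => i j; rewrite !mxE embdot_complex; congr (_ * _).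
by apply: eq_bigr => m _; rewrite !mxE.
Qed.

Lemma normc_sqr (z : C) : z * z^* = RtoC (ComplexField.Normc.normc z ^+ 2).
Proof. by rewrite -sqr_normc /RtoC rmorphXn. Qed.

Lemma bform_gram b u : bform (gram b) u u =
  n%:R^-1 * \sum_m ComplexField.Normc.normc ((map_mx RtoC u *m embmx b) 0 m) ^+ 2.
Proof.
apply: (@complexI R); rewrite -!RtoCE /bform.
have -> : RtoC ((u *m gram b *m u^T) 0 0) = (map_mx RtoC (u *m gram b *m u^T)) 0 0 by rewrite [RHS]mxE.
rewrite /RtoC !map_mxM -map_trmx -/RtoC gram_complex -scalemxAr -scalemxAl mxE.
rewrite RtoCE rmorphM fmorphV rmorph_nat rmorph_sum; congr (_ * _).
set v := map_mx _ u.
have vc : map_mx (@conjc R) v = v.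
  by apply/matrixP => i j; rewrite !mxE conjc_real.
have -> : v *m (embmx b *m (map_mx (@conjc R) (embmx b))^T) *m v^T =
   (v *m embmx b) *m (map_mx (@conjc R) (v *m embmx b))^T.
  by rewrite map_mxM vc trmx_mul !mulmxA.
rewrite mxE; apply: eq_bigr => m _; rewrite -[RHS]/(RtoC _) -normc_sqr.
by rewrite [_^T _ _]mxE [map_mx (@conjc R) _ _ _]mxE.
Qed.

Lemma dimK_gt0 : (0 < n)%N. Proof. by rewrite nK adim_gt0. Qed.

(** Symmetry comes from conjugation permuting the embeddings, positivity from the invertibility of
    [embmx b]. *)
Lemma posdef_gram b : is_basis b -> posdef (gram b).
Proof.
move=> bb; split.
  apply/matrixP => i j; rewrite !mxE; apply: (@complexI R); rewrite -!RtoCE !embdot_complex.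
  rewrite (sum_embeddings_conj (fun f => f (b j) * (f (b i))^*)); congr (_ * _).
  apply: eq_bigr => m _ /=. by rewrite [X in _ * X](conjcK (s m (b i))) mulrC.
move=> u u0; rewrite bform_gram pmulr_rgt0 ?invr_gt0 ?ltr0n ?dimK_gt0 //.
rewrite lt_def sumr_ge0 ?andbT; last by move=> m _; rewrite sqr_ge0.
apply: contraNneq u0 => /eqP; rewrite psumr_eq0; last by move=> m _; rewrite sqr_ge0.
move=> /allP h; have : map_mx RtoC u *m embmx b == 0.
  apply/eqP/rowP => m; have := h m (mem_index_enum _); rewrite sqrf_eq0 => /eqP.
  by move/ComplexField.Normc.eq0_normc => ->; rewrite [in RHS]mxE.
move/eqP => hu; have : map_mx RtoC u = 0 by rewrite -(mulmxK (embmx_unit bb) (map_mx RtoC u)) hu mul0mx.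
move/eqP; rewrite /RtoC map_mx_eq0 //.
Qed.

Definition basis_disc b : rat := \det (\matrix_(i, j) field_trace (b i * b j)).

Lemma field_trace_emb x : ratr (field_trace x) = \sum_m s m x.
Proof.
have [b bb ->] := field_trace_vbasis x nK.
rewrite -(trace_mulmat x bb); congr ratr.
by apply: eq_bigr => i _; rewrite mxE.
Qed.

Lemma basis_disc_embmx b : ratr (basis_disc b) = \det (embmx b) ^+ 2.
Proof.
rewrite /basis_disc -(det_map_mx (ratr : {rmorphism rat -> C})) expr2 -[X in _ = _ * X]det_tr -det_mulmx.
congr (\det _); apply/matrixP => i j; rewrite !mxE [LHS]field_trace_emb.
by apply: eq_bigr => m _; rewrite !mxE rmorphM.
Qed.

(** With [E = embmx b], the Gram matrix is [E] times its conjugate transpose over [n], and the trace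
    form has matrix [E E^T]; the two determinants meet in [|det E|^2]. *)
Lemma det_gram b : \det (gram b) = n%:R^-1 ^+ n * ratr `|basis_disc b|.
Proof.
apply: (@complexI R); rewrite -!RtoCE RtoCE -det_map_mx gram_complex detZ det_mulmx det_tr.
rewrite det_map_mx -sqr_normc RtoCE rmorphM rmorphXn fmorphV rmorph_nat; congr (_ * _).
rewrite -normrX -basis_disc_embmx.
by rewrite -ratr_norm -ratr_complex.
Qed.

Lemma embnormE x : embnorm R x =
  Num.sqrt (n%:R^-1 * \sum_m ComplexField.Normc.normc (s m x) ^+ 2).
Proof.
rewrite /embnorm -nK; congr (Num.sqrt (_ * _)).
have -> : @embeddings K R = [set (s m : K -> C) | m in [set` enum 'I_n]].
  apply/seteqP; split => [f [e _ <-]|f [m _ <-]].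
    by have [m ->] := sP.2 e; exists m => //=; rewrite mem_enum.
  by exists (s m).
rewrite fsbig_image; last by move=> m m' _ _; apply: sP.1.
by rewrite -fsbig_seq ?enum_uniq // big_enum.
Qed.

End Geometry.

(** * Lattices *)

Section Lattices.
Variables (K : fieldExtType rat) (n : nat).
Implicit Types (b : 'I_n -> K) (O : set K).

Definition zcomb b (c : 'rV[int]_n) : K := \sum_i b i *~ c 0 i.

Definition is_Zbasis b O := is_basis b /\ O = range (zcomb b).

Lemma zcombE b c : zcomb b c = \sum_i (c 0 i)%:~R *: b i.
Proof. by apply: eq_bigr => i _; rewrite scaler_int. Qed.

Lemma qcoord_zcomb b c j : is_basis b -> qcoord b j (zcomb b c) = (c 0 j)%:~R.
Proof. by move=> bb; rewrite zcombE qcoord_sum. Qed.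

Lemma zcomb_inj b : is_basis b -> injective (zcomb b).
Proof.
move=> bb c c' cc; apply/rowP => j; apply: (@intr_inj rat).
by rewrite -!(qcoord_zcomb _ _ bb) cc.
Qed.

Lemma zcomb_delta b i : zcomb b (delta_mx 0 i) = b i.
Proof.
rewrite /zcomb (bigD1 i) //= big1 ?addr0 ?mxE ?eqxx //.
by move=> j ji; rewrite mxE eqxx (negbTE ji).
Qed.

Lemma zcombD b c c' : zcomb b (c + c') = zcomb b c + zcomb b c'.
Proof. by rewrite /zcomb -big_split; apply: eq_bigr => i _; rewrite mxE mulrzDr. Qed.

Lemma zcombZ b (a : int) c : zcomb b (a *: c) = zcomb b c *~ a.
Proof. by rewrite /zcomb mulrz_suml; apply: eq_bigr => i _; rewrite mxE mulrC mulrzA. Qed.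

Lemma zcomb_mul b (M : 'M[int]_n) c :
  zcomb (fun i => zcomb b (row i M)) c = zcomb b (c *m M).
Proof.
rewrite {1}/zcomb; under eq_bigr do rewrite -zcombZ.
rewrite -(big_morph (zcomb b) (zcombD b) (_ : zcomb b 0 = 0)); last first.
  by rewrite /zcomb big1 // => i _; rewrite mxE.
by rewrite mulmx_sum_row.
Qed.

Lemma mem_Zbasis b O i : is_Zbasis b O -> O (b i).
Proof. by case=> _ ->; exists (delta_mx 0 i); rewrite ?zcomb_delta. Qed.

Lemma zcomb_mem b O c : is_Zbasis b O -> O (zcomb b c).
Proof. by case=> _ ->; exists c. Qed.

Lemma Zbasis_coord b O x : is_Zbasis b O -> O x -> exists c, x = zcomb b c.
Proof. by case=> _ -> [c _ <-]; exists c. Qed.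

Lemma Zbasis_unimodular b O (U : 'M[int]_n) :
  U \in unitmx -> is_Zbasis b O -> is_Zbasis (fun i => zcomb b (row i U)) O.
Proof.
move=> uU bO; have [bb OE] := bO; split; last first.
  rewrite OE; apply/seteqP; split => _ [c _ <-]; last first.
    by rewrite zcomb_mul; exists (c *m U).
  by exists (c *m invmx U) => //; rewrite zcomb_mul mulmxKV.
apply: is_basis_span; first exact: is_basis_dim bb.
move=> x; pose V : 'M[rat]_n := map_mx intr (invmx U).
exists (fun i => \sum_k qcoord b k x * V k i).
rewrite {1}(is_basis_sum x bb).
under [RHS]eq_bigr do rewrite scaler_suml.
rewrite exchange_big /=; apply: eq_bigr => k _.
under [RHS]eq_bigr do rewrite -scalerA.
rewrite -scaler_sumr; congr (_ *: _).
rewrite -[LHS](zcomb_delta b) -[delta_mx 0 k](mulmxKV uU) -rowE -zcomb_mul zcombE.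
by apply: eq_bigr => i _; rewrite !mxE.
Qed.

End Lattices.

Lemma Zbasis_function (K : fieldExtType rat) n (O : set K) : n = \dim {:K} ->
  (exists t, Zbasis O t) <-> (exists b : 'I_n -> K, is_Zbasis b O).
Proof.
move=> nK; split.
  case=> t [tb OE]; subst n; exists (fun i => t`_i); split.
    rewrite /is_basis [mktuple _](_ : _ = t) //.
    by apply: eq_from_tnth => i; rewrite tnth_mktuple -tnth_nth.
  rewrite OE; apply/seteqP; split => x /=.
    by case=> c ->; exists (\row_i c i) => //; apply: eq_bigr => i _; rewrite mxE.
  by case=> c _ <-; exists (fun i => c 0 i).
case=> b [bb OE]; subst n; exists [tuple b i | i < \dim {:K}]; split => //.
rewrite OE; apply/seteqP; split => x /=.
  case=> c _ <-; exists (fun i => c 0 i); apply: eq_bigr => i _.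
  by rewrite mktuple_nth.
case=> c ->; exists (\row_i c i) => //; apply: eq_bigr => i _.
by rewrite mxE mktuple_nth.
Qed.

(** * Norms and discriminants of lattices in a number field *)

Section LatticeGeometry.
Local Open Scope complex_scope.
Variables (K : fieldExtType rat) (R : realType) (n : nat).
Hypothesis nK : n = \dim {:K}.
Local Notation C := (R[i]).
Variable s : 'I_n -> {rmorphism K -> C}.
Hypothesis sP : embedding_enum s.
Implicit Types (b : 'I_n -> K) (x y : K) (O : set K).
Local Notation nrm := (ComplexField.Normc.normc).

Lemma embnorm_ge0 x : 0 <= embnorm R x.
Proof. exact: sqrtr_ge0. Qed.

Lemma embnorm_sqr x : embnorm R x ^+ 2 = n%:R^-1 * \sum_m nrm (s m x) ^+ 2.
Proof.
rewrite (embnormE nK sP) sqr_sqrtr // mulr_ge0 ?invr_ge0 ?ler0n //.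
by apply: sumr_ge0 => m _; rewrite sqr_ge0.
Qed.

Lemma emb_zcomb b c m : s m (zcomb b c) = (map_mx (@RtoC R) (realmx R c) *m embmx s b) 0 m.
Proof.
rewrite zcombE rmorph_sum mxE; apply: eq_bigr => i _; rewrite emb_scale !mxE.
by congr (_ * _); rewrite /RtoC ratr_int rmorph_int.
Qed.

Lemma embnorm_zcomb b c :
  embnorm R (zcomb b c) ^+ 2 = bform (gram s b) (realmx R c) (realmx R c).
Proof.
rewrite embnorm_sqr (bform_gram sP); congr (_ * _).
by apply: eq_bigr => m _; rewrite emb_zcomb.
Qed.

Lemma realmx_delta (i : 'I_n) : realmx R (delta_mx 0 i) = delta_mx 0 i :> 'rV_n.
Proof. exact: map_delta_mx. Qed.

Lemma embnorm_basis b i : embnorm R (b i) ^+ 2 = gram s b i i.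
Proof.
rewrite -{1}(zcomb_delta b i) embnorm_zcomb realmx_delta.
by rewrite /bform trmx_delta -rowE -colE !mxE.
Qed.

Lemma embnorm1 : embnorm R (1 : K) = 1.
Proof.
rewrite (embnormE nK sP); under eq_bigr do rewrite rmorph1 ComplexField.Normc.normc1 expr1n.
by rewrite sumr_const card_ord mulVf ?sqrtr1 // pnatr_eq0 -lt0n (dimK_gt0 nK).
Qed.

(** In [\sum_m |s_m x|^2 |s_m y|^2] one factor of each term is enlarged to its full sum over [m]. As
    the norm averages over the embeddings, this costs a factor [n] in the square. *)
Lemma embnormM x y :
  embnorm R (x * y) <= Num.sqrt n%:R * embnorm R x * embnorm R y.
Proof.
have n0 : (0 : R) < n%:R by rewrite ltr0n (dimK_gt0 nK).
rewrite -(ler_pXn2r (_ : 0 < 2)%N) ?nnegrE ?mulr_ge0 ?sqrtr_ge0 //.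
rewrite !exprMn !embnorm_sqr sqr_sqrtr ?ler0n // mulVKf ?gt_eqF // mulrCA.
rewrite ler_pM2l ?invr_gt0 // mulr_suml; apply: ler_sum => m _.
rewrite rmorphM ComplexField.Normc.normcM exprMn ler_wpM2l ?sqr_ge0 //.
by rewrite (bigD1 m) //= lerDl sumr_ge0 // => i _; rewrite sqr_ge0.
Qed.

Lemma embmx_zcomb b (M : 'M[int]_n) :
  embmx s (fun i => zcomb b (row i M)) = map_mx intr M *m embmx s b.
Proof.
apply/matrixP => i m; rewrite mxE emb_zcomb !mxE; apply: eq_bigr => j _.
by rewrite !mxE /RtoC rmorph_int.
Qed.

Lemma basis_disc_zcomb b (M : 'M[int]_n) :
  basis_disc (fun i => zcomb b (row i M)) = (\det M)%:~R ^+ 2 * basis_disc b.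
Proof.
apply: (fmorph_inj (ratr : {rmorphism rat -> C})) => /=.
rewrite rmorphM /= !(basis_disc_embmx nK sP) embmx_zcomb det_mulmx exprMn; congr (_ * _).
by rewrite det_map_mx rmorphXn /= ratr_int.
Qed.

Lemma Zbasis_change b b' O : is_Zbasis b O -> is_Zbasis b' O ->
  exists2 M : 'M[int]_n, M \in unitmx & b' = fun i => zcomb b (row i M).
Proof.
move=> bO bO'.
have P i := Zbasis_coord bO (mem_Zbasis i bO'); have P' i := Zbasis_coord bO' (mem_Zbasis i bO).
pose M : 'M[int]_n := \matrix_i projT1 (cid (P i)).
pose M' : 'M[int]_n := \matrix_i projT1 (cid (P' i)).
have ME : b' = fun i => zcomb b (row i M).
  by apply/funext => i; rewrite rowK; case: cid.
have ME' : b = fun i => zcomb b' (row i M').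
  by apply/funext => i; rewrite rowK; case: cid.
exists M => //; have : M' *m M = 1%:M.
  apply/row_matrixP => i; apply: (zcomb_inj bO.1).
  by rewrite row_mul -zcomb_mul -ME row1 zcomb_delta [in RHS]ME'.
by move/mulmx1_unit => [].
Qed.

Lemma basis_disc_unique b b' O : is_Zbasis b O -> is_Zbasis b' O -> basis_disc b = basis_disc b'.
Proof.
move=> bO bO'; have [M uM ->] := Zbasis_change bO bO'; rewrite basis_disc_zcomb.
by rewrite -rmorphXn int_unit_sqr ?mul1r // -unitmxE.
Qed.

Lemma basis_disc_neq0 b : is_basis b -> basis_disc b != 0.
Proof.
move=> bb; rewrite -(fmorph_eq0 (ratr : {rmorphism rat -> C})) /= (basis_disc_embmx nK sP).
by rewrite expf_neq0 // -unitfE -unitmxE (embmx_unit sP bb).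
Qed.

Lemma mulmat_int b O x : is_Zbasis b O -> (forall x y, O x -> O y -> O (x * y)) -> O x ->
  exists M : 'M[int]_n, mulmat b x = map_mx intr M.
Proof.
move=> bO OM Ox; have P i := Zbasis_coord bO (OM _ _ Ox (mem_Zbasis i bO)).
exists (\matrix_i projT1 (cid (P i))); apply/matrixP => i j; rewrite [LHS]mxE.
have -> : x * b i = zcomb b (row i (\matrix_i projT1 (cid (P i)))).
  by rewrite rowK; case: cid.
by rewrite (qcoord_zcomb _ _ bO.1) !mxE.
Qed.

(** Multiplication by [x] has an integral matrix in a Z-basis, so the norm of [x] is a nonzero
    integer; the inequality of arithmetic and geometric means passes from the product of the
    [|s_m x|^2] to their mean. *)
Lemma embnorm_ge1 b O x : is_Zbasis b O -> (forall x y, O x -> O y -> O (x * y)) ->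
  O x -> x != 0 -> 1 <= embnorm R x.
Proof.
move=> bO OM Ox x0.
have n0 : (0 : R) < n%:R by rewrite ltr0n (dimK_gt0 nK).
have [M ME] := mulmat_int bO OM Ox.
have prodE : \prod_m s m x = (\det M)%:~R.
  by rewrite -(det_mulmat sP x bO.1) ME det_map_mx /= ratr_int.
have dM : \det M != 0.
  apply/eqP => d0; move: prodE; rewrite d0 => /eqP /prodf_eq0 [m _].
  by rewrite fmorph_eq0 (negbTE x0).
have P1 : 1 <= \prod_m (nrm (s m x) ^+ 2) :> R.
  rewrite prodrXl exprn_ege1 //.
  have -> : \prod_m nrm (s m x) = nrm (\prod_m s m x).
    by rewrite (big_morph _ (@ComplexField.Normc.normcM R) (@ComplexField.Normc.normc1 R)).
  rewrite prodE -lecR -[X in _ <= X]/(`|(\det M)%:~R : C|) -intr_norm rmorph1 ler1z.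
  by move: dM; move: (\det M) => m; lia.
have := leif_AGM (A := 'I_n) (E := fun m => nrm (s m x) ^+ 2) (fun m _ => sqr_ge0 _).
rewrite card_ord => -[+ _] => /(le_trans P1).
rewrite [_ / _]mulrC -embnorm_sqr -exprM => h.
rewrite leNgt; apply/negP => lt1; move: h; apply/negP; rewrite -ltNge.
by rewrite exprn_ilt1 ?embnorm_ge0 // muln_eq0 -lt0n (dimK_gt0 nK).
Qed.

End LatticeGeometry.

Lemma abs_disc_basis (R : realType) (K : fieldExtType rat) n (b : 'I_n -> K) O :
  is_Zbasis b O -> abs_disc O = `|basis_disc b|.
Proof.
move=> bO; have nK := is_basis_dim bO.1.
have [b0 b0P] : exists b0, Zbasis O b0 by apply/(Zbasis_function O nK); exists b.
rewrite /abs_disc; have := xgetPex (vbasis {:K}) (ex_intro [set t | Zbasis O t] b0 b0P).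
move: (xget _ _) => t /= tP.
subst n; congr `|_|; set b' := fun i : 'I_(\dim {:K}) => t`_i.
have [s sP] := embedding_enum_exists K R.
have tO : is_Zbasis b' O.
  case: tP => tb OE; split.
    rewrite /is_basis [mktuple _](_ : _ = t) //.
    by apply: eq_from_tnth => i; rewrite tnth_mktuple /b' -tnth_nth.
  rewrite OE; apply/seteqP; split => x /=.
    by case=> c ->; exists (\row_i c i) => //; apply: eq_bigr => i _; rewrite mxE.
  by case=> c _ <-; exists (fun i => c 0 i).
exact: (basis_disc_unique (erefl _) sP tO bO).
Qed.

(** * Successive minima *)

Section Span.
Variable K : fieldExtType rat.
Implicit Types (A B : set K) (V W : {vspace K}).

(** A subspace of least dimension containing [A] lies in every other such subspace, since its
    intersection with that one cannot be smaller. *)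
Lemma vspanP A : A `<=` [set` vspan A] /\
  forall W, A `<=` [set` W] -> (vspan A <= W)%VS.
Proof.
rewrite /vspan; apply: (@xgetPex _ 0%VS [set V : {vspace K} | A `<=` [set` V] /\
    forall W : {vspace K}, A `<=` [set` W] -> (V <= W)%VS]).
pose P d := `[< exists V : {vspace K}, A `<=` [set` V] /\ \dim V = d >].
have exP : exists d, P d.
  by exists (\dim {:K}); apply/asboolP; exists fullv; split => // x _ /=; rewrite memvf.
case: (ex_minnP exP) => d /asboolP[V [AV dV]] dmin; exists V; split => // W AW.
have : (d <= \dim (V :&: W))%N.
  apply: dmin; apply/asboolP; exists (V :&: W)%VS; split => // x Ax /=.
  by rewrite memv_cap; apply/andP; split; [apply: AV|apply: AW].
by rewrite -dV (geq_leqif (dimv_leqif_sup (capvSl V W))) subv_cap => /andP[].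
Qed.

Lemma sub_vspan A x : A x -> x \in vspan A.
Proof. exact: (vspanP A).1. Qed.

Lemma vspan_sub A W : (forall x, A x -> x \in W) -> (vspan A <= W)%VS.
Proof. exact: (vspanP A).2. Qed.

Lemma vspanS A B : A `<=` B -> (vspan A <= vspan B)%VS.
Proof. by move=> AB; apply: vspan_sub => x /AB; apply: sub_vspan. Qed.

Lemma vspan_vs V : vspan [set` V] = V.
Proof.
apply/eqP; rewrite eqEsubv vspan_sub //=; apply/subvP => x xV.
exact: sub_vspan.
Qed.

(** With one factor fixed, the admissible other factors form a subspace, the preimage of [V] under
    multiplication; this is applied to each factor in turn. *)
Lemma vspan_prod A B V : (forall x y, A x -> B y -> x * y \in V) ->
  forall x y, x \in vspan A -> y \in vspan B -> x * y \in V.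
Proof.
move=> ABV.
have H B0 a : (forall z, B0 z -> a * z \in V) -> forall z, z \in vspan B0 -> a * z \in V.
  move=> h z zB; have : (vspan B0 <= amull a @^-1: V)%VS.
    by apply: vspan_sub => u uB; rewrite -memv_preim lfunE; apply: h.
  by move/subvP/(_ _ zB); rewrite -memv_preim lfunE.
move=> x y xA yB; apply: (H B) yB => z zB; rewrite mulrC; apply: (H A) xA => u uA.
by rewrite mulrC; apply: ABV.
Qed.

End Span.

Lemma short_mono (K : fieldExtType rat) (R : realType) (O : set K) (r r' : R) :
  r <= r' -> short O r `<=` short O r'.
Proof. by move=> rr x [Ox /= xr]; split => //=; apply: le_trans rr. Qed.

Section Minima.
Variables (K : fieldExtType rat) (R : realType) (n : nat).
Hypothesis nK : n = \dim {:K}.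
Local Notation C := (R[i]).
Variable s : 'I_n -> {rmorphism K -> C}.
Hypothesis sP : embedding_enum s.
Variables (b : 'I_n -> K) (O : set K).
Hypotheses (bO : is_Zbasis b O) (O1 : O 1) (OM : forall x y, O x -> O y -> O (x * y)).
Local Notation N := (embnorm R).
Local Notation lam := (succ_min R O).
Local Notation V r := (vspan (short O (r : R))).

Lemma finite_short (r : R) : finite_set (short O r).
Proof.
apply: (@sub_finite_set _ _ (zcomb b @` [set c | bform (gram s b) (realmx R c) (realmx R c) <= r ^+ 2])).
  move=> x [Ox /= xr]; have [c cE] := Zbasis_coord bO Ox; exists c => //=.
  rewrite -(embnorm_zcomb nK sP) -cE ler_pXn2r ?nnegrE ?embnorm_ge0 //.
  exact: le_trans (embnorm_ge0 _ x) xr.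
by apply: finite_image; apply: posdef_finite; apply: posdef_gram bO.1.
Qed.

Lemma order_norm_ge1 x : O x -> x != 0 -> 1 <= N x.
Proof. exact: (embnorm_ge1 nK sP bO OM). Qed.

(** [succ_min] is chosen by [xget] with default 0, so it means something only once the minimum is
    known to be attained. *)
Lemma succ_min_spec i : (i < n)%N ->
  [/\ 0 < lam i, (i.+1 <= \dim (V (lam i)))%N &
   forall r, 0 < r -> (i.+1 <= \dim (V r))%N -> lam i <= r].
Proof.
move=> ilt; pose Z := [set r : R | 0 < r /\ (i.+1 <= \dim (V r))%N].
suff [m Zm mP] : exists2 m, Z m & lbound Z m.
  have [[h1 h2] h3] : (Z `&` lbound Z) (lam i).
    by apply: (@xgetPex _ 0 (Z `&` lbound Z)); exists m.
  by split => // r r0 rV; apply: h3.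
(* This radius admits the whole Z-basis, so the set of radii is nonempty. *)
pose r0 := 1 + \sum_j N (b j).
have Zr0 : Z r0.
  have r00 : 0 < r0 by rewrite ltr_wpDr // sumr_ge0 // => j _; apply: embnorm_ge0.
  split=> //; suff -> : V r0 = fullv by rewrite -nK.
  apply/eqP; rewrite eqEsubv subvf /= -(span_basis bO.1); apply/span_subvP => x.
  case/tnthP => j ->; rewrite tnth_mktuple; apply: sub_vspan; split; first exact: mem_Zbasis bO.
  rewrite /= /r0 (bigD1 j) //= addrCA lerDl addr_ge0 // sumr_ge0 // => k _.
  exact: embnorm_ge0.
(* An admissible radius can be lowered to the largest norm of an element within it, which confines
   the search to the finitely many norms up to [r0]. *)
have claim r : Z r -> exists2 x, O x & N x <= r /\ Z (N x).
  move=> [rp rV].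
  have [x0 x0s x00] : exists2 x, short O r x & x != 0.
    apply: contrapT => h; suff : (V r <= 0)%VS.
      by rewrite subv0 -dimv_eq0 => /eqP d0; rewrite d0 in rV.
    apply: vspan_sub => x xs; rewrite memv0; apply/negPn/negP => x0.
    by apply: h; exists x.
  have [x xs xP] := finite_min (fun x => - N x) (finite_short r) x0s.
  exists x; first exact: xs.1.
  have x0x : N x0 <= N x by rewrite -lerN2 xP.
  split; first exact: xs.2.
  split; first by apply: lt_le_trans x0x; apply: lt_le_trans (order_norm_ge1 x0s.1 x00).
  apply: leq_trans rV _; apply: dimvS; apply: vspanS => y ys; split; first exact: ys.1.
  by rewrite /= -lerN2 xP.
have Sf : finite_set [set x | O x /\ (N x <= r0 /\ Z (N x))].
  by apply: sub_finite_set (finite_short r0) => x [Ox [xr _]].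
have [x1 Ox1 x1P] := claim _ Zr0.
have [x [Ox [xr Zx]] xP] := finite_min N Sf (x0 := x1) (conj Ox1 x1P).
exists (N x) => // r Zr; have [rr0|/ltW r0r] := leP r r0; last exact: le_trans r0r.
have [y Oy [yr Zy]] := claim _ Zr; apply: (le_trans _ yr); apply: xP.
by split => //; split => //; apply: le_trans yr rr0.
Qed.

Lemma succ_min_gt0 i : (i < n)%N -> 0 < lam i.
Proof. by case/succ_min_spec. Qed.

Lemma succ_min_dim i : (i < n)%N -> (i.+1 <= \dim (V (lam i)))%N.
Proof. by case/succ_min_spec. Qed.

Lemma succ_min_le i r : (i < n)%N -> 0 < r -> (i.+1 <= \dim (V r))%N -> lam i <= r.
Proof. by case/succ_min_spec => _ _; apply. Qed.

Lemma succ_min_mono i j : (i <= j)%N -> (j < n)%N -> lam i <= lam j.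
Proof.
move=> ij jn; apply: succ_min_le; rewrite ?succ_min_gt0 ?(leq_ltn_trans ij) //.
exact: leq_trans (succ_min_dim jn).
Qed.

Lemma short_small (r : R) x : short O r x -> r < 1 -> x = 0.
Proof.
case=> Ox /= xr r1; apply/eqP/negPn/negP => /(order_norm_ge1 Ox).
by move=> /le_trans /(_ xr); rewrite leNgt r1.
Qed.

Lemma succ_min_ge1 i : (i < n)%N -> 1 <= lam i.
Proof.
move=> ilt; rewrite leNgt; apply/negP => l1; have := succ_min_dim ilt.
suff -> : V (lam i) = 0%VS by rewrite dimv0.
apply/eqP; rewrite -subv0; apply: vspan_sub => x /short_small -> //.
exact: mem0v.
Qed.

Lemma mem1_V (r : R) : 1 <= r -> 1 \in V r.
Proof. by move=> r1; apply: sub_vspan; split => //=; rewrite (embnorm1 nK sP). Qed.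

(** Greedy choice: the short elements for [lam k] span more than [k] dimensions, so one of them lies
    outside the span of the [k] vectors already chosen. *)
Lemma minima_vectors : exists2 w : 'I_n -> K, is_basis w &
  forall i : 'I_n, O (w i) /\ N (w i) <= lam i.
Proof.
have H k : (k <= n)%N -> exists ws : seq K, [/\ size ws = k, free ws &
    forall i, (i < k)%N -> short O (lam i) ws`_i].
  elim: k => [_|k IH kn]; first by exists [::]; rewrite nil_free.
  have [ws [sws fws wsP]] := IH (ltnW kn).
  have [x xs xws] : exists2 x, short O (lam k) x & x \notin <<ws>>%VS.
    apply: contrapT => h; suff : (V (lam k) <= <<ws>>)%VS.
      move/dimvS; rewrite (eqnP fws) sws leqNgt; apply/negP/negPn.
      exact: succ_min_dim kn.
    by apply: vspan_sub => x xs; apply/negPn/negP => xw; apply: h; exists x.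
  exists (rcons ws x); split; first by rewrite size_rcons sws.
    by rewrite -(perm_free (_ : perm_eq (x :: ws) _)) ?free_cons ?xws // perm_sym perm_rcons.
  move=> i; rewrite ltnS nth_rcons sws leq_eqVlt => /orP[/eqP ->|ik].
    by rewrite ltnn eqxx.
  by rewrite ik; apply: wsP.
have [ws [sws fws wsP]] := H n (leqnn n).
exists (fun i => ws`_i); last by move=> i; have [] := wsP i (ltn_ord i).
rewrite /is_basis basisEfree subvf size_tuple -nK leqnn !andbT.
rewrite (_ : tval _ = ws) //; apply: (@eq_from_nth _ 0); rewrite ?size_tuple //.
by move=> i ilt; rewrite (mktuple_nth (fun i : 'I_n => ws`_i) (Ordinal ilt)).
Qed.

(** The vectors of [minima_vectors] span a sublattice of finite index, whose discriminant is that of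
    [O] times the squared index; its Gram determinant is bounded through the diagonal. *)
Lemma disc_le_minima :
  ratr (abs_disc O) <= n%:R ^+ n * n`!%:R * (\prod_(i < n) lam i) ^+ 2 :> R.
Proof.
have [w wb wP] := minima_vectors.
have P i := Zbasis_coord bO (wP i).1.
pose M : 'M[int]_n := \matrix_i projT1 (cid (P i)).
have ME : w = fun i => zcomb b (row i M).
  by apply/funext => i; rewrite rowK; case: cid.
have n0 : (0 : R) < n%:R by rewrite ltr0n (dimK_gt0 nK).
have dw := basis_disc_neq0 nK sP wb.
have le1 : abs_disc O <= `|basis_disc w|.
  rewrite (abs_disc_basis R bO); move: dw; rewrite ME (basis_disc_zcomb nK sP) mulf_eq0 negb_or.
  rewrite expf_eq0 /= intr_eq0 => /andP[dM _].
  rewrite normrM ler_peMl // normrX exprn_ege1 // -intr_norm ler1z.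
  by move: dM; move: (\det M) => m; lia.
apply: le_trans (_ : ratr `|basis_disc w| <= _); first by rewrite ler_rat.
have -> : ratr `|basis_disc w| = n%:R ^+ n * \det (gram s w).
  by rewrite (det_gram nK sP) mulrA -exprMn mulfV ?gt_eqF // expr1n mul1r.
rewrite -mulrA ler_pM2l ?exprn_gt0 //.
apply: le_trans (posdef_det_le (posdef_gram nK sP wb)) _.
rewrite ler_pM2l ?ltr0n ?fact_gt0 // -prodrXl; apply: ler_prod => i _.
rewrite -(embnorm_basis nK sP) sqr_ge0 /= ler_pXn2r ?nnegrE ?embnorm_ge0 //.
  exact: (wP i).2.
by rewrite ltW // succ_min_gt0.
Qed.

(** After sorting the basis by norm, the vectors in positions 0 to [i] are independent and no longer
    than the one in position [i], which bounds [lam i]. *)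
Lemma minima_le_basis : \prod_(i < n) lam i <= \prod_(i < n) N (b i).
Proof.
pose le (i j : 'I_n) := N (b i) <= N (b j).
pose t := sort le (enum 'I_n).
have tt : total le by move=> i j; apply: le_total.
have ttr : transitive le by move=> j i k; apply: le_trans.
have pt : perm_eq t (enum 'I_n) by rewrite perm_sort.
have st : size t = n by rewrite size_sort size_enum_ord.
have ts : sorted le t by apply: sort_sorted.
pose i0 : 'I_n := Ordinal (dimK_gt0 nK).
have -> : \prod_(i < n) N (b i) = \prod_(i < n) N (b (nth i0 t i)).
  rewrite -big_enum -(perm_big _ pt) /= (big_nth i0) st.
  by rewrite big_mkord.
have fb : free [seq b j | j <- t].
  rewrite (perm_free (perm_map b pt)).
  rewrite (_ : map _ _ = [tuple b i | i < n]) ?(basis_free bO.1) //.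
apply: ler_prod => i _; rewrite ltW ?succ_min_gt0 //=.
have bi0 : b (nth i0 t i) != 0.
  by apply: (free_not0 fb); apply: map_f; rewrite mem_nth // st.
have r1 := order_norm_ge1 (mem_Zbasis _ bO) bi0.
apply: succ_min_le => //; first exact: lt_le_trans r1.
set X := [seq b j | j <- take i.+1 t].
have fX : free X.
  by move: fb; rewrite -(cat_take_drop i.+1 t) map_cat => /catl_free.
have -> : i.+1 = size X by rewrite size_map size_takel // st.
rewrite -(eqnP fX); apply: dimvS; apply/span_subvP => x /mapP[j jt ->].
apply: sub_vspan; split; first exact: mem_Zbasis bO.
move: jt => /(nthP i0) [k]; rewrite size_takel ?st // => ki <-; rewrite nth_take //=.
apply: (sorted_leq_nth ttr (fun j => lexx _) i0 ts) => //; rewrite inE st //.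
exact: leq_trans ki _.
Qed.

End Minima.

(** * Orders of bounded discriminant *)

(** Hermite reduction of the Gram matrix; the factor [n^-n] converts its determinant into the
    discriminant. *)
Lemma reduced_basis (R : realType) n : exists2 D : R, 0 < D &
  forall (K : fieldExtType rat) (O : set K) (b : 'I_n -> K), n = \dim {:K} -> is_Zbasis b O ->
  exists2 b' : 'I_n -> K, is_Zbasis b' O &
    \prod_i embnorm R (b' i) ^+ 2 <= D * ratr (abs_disc O).
Proof.
have [D D0 DP] := hermite_reduction R n.
have [->|n0] := posnP n.
  exists 1 => // K O b nK; have := adim_gt0 (aspacef K); rewrite -nK //.
have n0R : (0 : R) < n%:R by rewrite ltr0n.
exists (D * n%:R^-1 ^+ n); first by rewrite mulr_gt0 ?exprn_gt0 ?invr_gt0.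
move=> K O b nK bO.
have [s sP] : exists s : 'I_n -> {rmorphism K -> R[i]}, embedding_enum s.
  by subst n; apply: embedding_enum_exists.
have [U uU UP] := DP _ (posdef_gram nK sP bO.1).
exists (fun i => zcomb b (row i U)); first exact: Zbasis_unimodular.
under eq_bigr do rewrite (embnorm_zcomb nK sP).
by apply: le_trans UP _; rewrite (det_gram nK sP) (abs_disc_basis R bO) mulrA.
Qed.

Lemma det_le_bound (R : realType) n (A : 'M[R]_n) Y :
  (forall i j, `|A i j| <= Y) -> `|\det A| <= n`!%:R * Y ^+ n.
Proof.
move=> AY; apply: le_trans (ler_norm_sum _ _ _) _.
have -> : n`!%:R * Y ^+ n = \sum_(s : 'S_n) \prod_(i < n) Y.
  by rewrite sumr_const card_Sn prodr_const card_ord mulr_natl.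
apply: ler_sum => s _; rewrite normrM normrX normrN1 expr1n mul1r normr_prod.
by apply: ler_prod => i _; rewrite normr_ge0 AY.
Qed.

Lemma abs_disc_gt0 (R : realType) (K : fieldExtType rat) n (b : 'I_n -> K) O :
  is_Zbasis b O -> 0 < abs_disc O.
Proof.
move=> bO; rewrite (abs_disc_basis R bO) normr_gt0; have nK := is_basis_dim bO.1.
have [s sP] : exists s : 'I_n -> {rmorphism K -> R[i]}, embedding_enum s.
  by subst n; apply: embedding_enum_exists.
exact: (basis_disc_neq0 nK sP bO.1).
Qed.

(** All norms in a reduced basis are at least 1, so the bound on their product bounds each of them.
    The Gram matrix and its inverse are then bounded, and with them the coordinates of [b i * b j],
    uniformly in the field. *)
Lemma structure_constants_bounded (R : realType) n (X : rat) : exists B : nat,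
  forall (K : fieldExtType rat) (O : set K), n = \dim {:K} -> is_order O ->
  abs_disc O <= X -> exists2 b : 'I_n -> K, is_Zbasis b O &
  exists c : 'I_n -> 'I_n -> 'rV[int]_n,
    (forall i j k, `|c i j 0 k| <= B%:Z) /\ forall i j, b i * b j = zcomb b (c i j).
Proof.
have [D D0 DP] := reduced_basis R n.
have [n00|n0] := posnP n.
  exists 0%N => K O nK; have := adim_gt0 (aspacef K); rewrite -nK n00 //.
have n0R : (0 : R) < n%:R by rewrite ltr0n.
(* [Y] bounds squared norms and Gram entries; [Z] bounds the diagonal of the inverse Gram matrix, as
   an inverse determinant times a cofactor; [W] bounds squared coordinates of a product, whose
   squared norm is at most [n Y Y]. *)
pose Y : R := 1 + D * ratr `|X|.
pose Z : R := (D * n%:R ^+ n) * ((n.-1)`!%:R * Y ^+ n.-1).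
pose W : R := n%:R * Y * Y * Z.
exists (Num.truncn (1 + W)).+1 => K O nK Oord OX.
have [/(Zbasis_function O nK)[b0 b0O] O1 OM] := Oord.
have [b bO bP] := DP _ _ _ nK b0O.
have [s sP] : exists s : 'I_n -> {rmorphism K -> R[i]}, embedding_enum s.
  by subst n; apply: embedding_enum_exists.
have gp := posdef_gram nK sP bO.1.
have d0 : 0 < ratr (abs_disc O) :> R by rewrite ltr0q (abs_disc_gt0 R bO).
have b1 i : 1 <= embnorm R (b i) ^+ 2.
  apply: exprn_ege1; apply: (order_norm_ge1 nK sP bO OM); first exact: mem_Zbasis bO.
  apply: (basis_not0 bO.1); rewrite -(mktuple_nth b) mem_nth // size_tuple //.
have DX : D * ratr (abs_disc O) <= Y - 1.
  by rewrite /Y addrC addKr ler_pM2l // ler_rat (le_trans OX) // ler_norm.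
have bY i : embnorm R (b i) ^+ 2 <= Y.
  apply: le_trans (_ : Y - 1 <= _); last by rewrite gerBl.
  apply: le_trans DX; apply: le_trans bP.
  rewrite (bigD1 i) //= ler_peMr ?sqr_ge0 //.
  by apply: (big_ind (fun z => 1 <= z)) => // x y; apply: mulr_ege1.
have Y0 : 0 <= Y by apply: le_trans (bY (Ordinal n0)); rewrite sqr_ge0.
have gY i j : `|gram s b i j| <= Y.
  rewrite -(ler_pXn2r (_ : 0 < 2)%N) ?nnegrE // -normrX ger0_norm ?sqr_ge0 //.
  have := posdef_CS (delta_mx 0 i) (delta_mx 0 j) gp.
  rewrite /bform !trmx_delta -!rowE -!colE !mxE => /le_trans; apply.
  have E k : embdot s (b k) (b k) = embnorm R (b k) ^+ 2.
    by rewrite (embnorm_basis nK sP) mxE.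
  by rewrite !E [Y ^+ 2]expr2 ler_pM ?sqr_ge0.
(* As the squared norms have product at least 1, the reduction inequality reads as a lower bound on
   the determinant. *)
have detg : (D * n%:R ^+ n)^-1 <= \det (gram s b).
  rewrite -[X in X <= _]mul1r ler_pdivrMr ?mulr_gt0 ?exprn_gt0 //.
  have P1 : 1 <= \prod_i embnorm R (b i) ^+ 2.
    by apply: (big_ind (fun z => 1 <= z)) => // x y; apply: mulr_ege1.
  apply: le_trans P1 (le_trans bP _); rewrite (det_gram nK sP) (abs_disc_basis R bO).
  rewrite exprVn le_eqVlt; apply/orP; left; apply/eqP.
  have : (n%:R : R) ^+ n != 0 by rewrite expf_neq0 // gt_eqF.
  by move: (_ ^+ n) (ratr _) => u v u0; field.
have gi k : `|invmx (gram s b) k k| <= Z.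
  rewrite /invmx (posdef_unit gp) !mxE normrM ler_pM //.
    have dg0 : 0 < \det (gram s b) by apply: lt_le_trans detg; rewrite invr_gt0 mulr_gt0 ?exprn_gt0.
    rewrite normfV (ger0_norm (ltW dg0)) -[X in _ <= X]invrK lef_pV2 ?posrE //.
    by rewrite invr_gt0 mulr_gt0 ?exprn_gt0.
  rewrite /cofactor normrM normrX normrN1 expr1n mul1r.
  by apply: det_le_bound => i j; rewrite !mxE -[X in `|X|](_ : gram s b (lift k i) (lift k j) = _) ?gY ?mxE.
have P i j := Zbasis_coord bO (OM _ _ (mem_Zbasis i bO) (mem_Zbasis j bO)).
exists b => //; exists (fun i j => projT1 (cid (P i j))); split; last by move=> i j; case: cid.
move=> i j k; case: cid => /= c cE.
have cW : `|(c 0 k)%:~R| ^+ 2 <= W :> R.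
  have := posdef_coord_le (realmx R c) k gp; rewrite mxE -normrX ger0_norm ?sqr_ge0 //.
  move/le_trans; apply; rewrite -(embnorm_zcomb nK sP) -cE.
  apply: le_trans (ler_norm _) _; rewrite normrM ler_pM // ger0_norm ?sqr_ge0 //.
  apply: le_trans (_ : (Num.sqrt n%:R * embnorm R (b i) * embnorm R (b j)) ^+ 2 <= _).
    by rewrite ler_pXn2r ?nnegrE ?mulr_ge0 ?embnorm_ge0 ?sqrtr_ge0 // (embnormM nK sP).
  rewrite !exprMn sqr_sqrtr ?ler0n //.
  apply: ler_pM => //; [by rewrite mulr_ge0 ?sqr_ge0 ?ler0n | exact: sqr_ge0 |].
  by rewrite ler_wpM2l ?ler0n.
have W0 : 0 <= W by apply: le_trans cW; rewrite sqr_ge0.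
have cW1 : `|(c 0 k)%:~R| <= 1 + W.
  move: (normr_ge0 ((c 0 k)%:~R : R)) cW; move: `|_| => z z0 zB.
  by rewrite leNgt; apply/negP => h; nra.
have : (absz (c 0 k)%R <= Num.truncn (1 + W))%N.
  rewrite -(@natrK R (absz (c 0 k)%R)); apply: le_truncn.
  by rewrite natr_absz intr_norm.
by move: (c 0 k) (Num.truncn _) => u v; clear; lia.
Qed.

(** * Linear extension of a map between bases *)

Section LinearExtension.
Variables (K K' : fieldExtType rat) (n : nat) (b : 'I_n -> K) (b' : 'I_n -> K').

Definition linext (x : K) : K' := \sum_i qcoord b i x *: b' i.

Lemma linextP a x y : linext (a *: x + y) = a *: linext x + linext y.
Proof.
rewrite /linext scaler_sumr -big_split; apply: eq_bigr => i _.
by rewrite qcoord_lin scalerDl scalerA.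
Qed.

Lemma linext0 : linext 0 = 0.
Proof. by have := linextP (-1) 0 0; rewrite scaler0 addr0 scaleN1r addNr. Qed.

Lemma linextD x y : linext (x + y) = linext x + linext y.
Proof. by rewrite -{1}[x]scale1r linextP scale1r. Qed.

Lemma linextZ a x : linext (a *: x) = a *: linext x.
Proof. by rewrite -[a *: x]addr0 linextP linext0 addr0. Qed.

Lemma linext_sum I (r : seq I) (F : I -> K) :
  linext (\sum_(i <- r) F i) = \sum_(i <- r) linext (F i).
Proof. exact: (big_morph _ linextD linext0). Qed.

Hypothesis bb : is_basis b.

Lemma linext_basis i : linext (b i) = b' i.
Proof.
rewrite /linext (bigD1 i) //= big1 ?addr0 ?qcoord_delta ?eqxx ?scale1r //.
by move=> j ji; rewrite qcoord_delta // eq_sym (negbTE ji) scale0r.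
Qed.

Lemma linext_zcomb c : linext (zcomb b c) = zcomb b' c.
Proof.
rewrite !zcombE linext_sum; apply: eq_bigr => i _.
by rewrite linextZ linext_basis.
Qed.

Lemma linextM : (forall i j, linext (b i * b j) = b' i * b' j) ->
  forall x y, linext (x * y) = linext x * linext y.
Proof.
move=> bM x y; rewrite {1}(is_basis_sum x bb) {1}(is_basis_sum y bb) {2 3}/linext.
rewrite !mulr_suml linext_sum; apply: eq_bigr => i _.
rewrite !mulr_sumr linext_sum; apply: eq_bigr => j _.
by rewrite -!scalerAl -!scalerAr !linextZ bM.
Qed.

Lemma linext_rmorph : (forall i j, linext (b i * b j) = b' i * b' j) ->
  linext 1 = 1 -> exists e : {rmorphism K -> K'}, (e : K -> K') = linext.
Proof.
move=> bM l1.
have fa : zmod_morphism linext.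
  by move=> x y; rewrite -scaleN1r addrC linextP scaleN1r addrC.
have fm : monoid_morphism linext by split => //; apply: linextM.
pose fA := GRing.isZmodMorphism.Build K K' linext fa.
pose fM := GRing.isMonoidMorphism.Build K K' linext fm.
pose F : {rmorphism K -> K'} := HB.pack linext fA fM.
by exists F.
Qed.

Lemma linext_inj : is_basis b' -> injective linext.
Proof.
move=> bb' x y xy; rewrite (is_basis_sum x bb) (is_basis_sum y bb).
apply: eq_bigr => i _; congr (_ *: _).
rewrite -(qcoord_sum (fun i => qcoord b i x) i bb').
by rewrite -(qcoord_sum (fun i => qcoord b i y) i bb') -/(linext x) xy.
Qed.

End LinearExtension.

Lemma order_iso_structure (O O' : numorder) n (b : 'I_n -> ofield O)
    (b' : 'I_n -> ofield O') (c : 'I_n -> 'I_n -> 'rV[int]_n) :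
  is_Zbasis b (oset O) -> is_Zbasis b' (oset O') -> (forall i j, b i * b j = zcomb b (c i j)) ->
  (forall i j, b' i * b' j = zcomb b' (c i j)) -> order_iso O O'.
Proof.
move=> bO bO' bE bE'; pose g := linext b b'.
have gM : forall x y, g (x * y) = g x * g y.
  by apply: linextM bO.1 _ => i j; rewrite bE linext_zcomb ?bE' //; exact: bO.1.
have gI : injective g := linext_inj bO.1 bO'.1.
exists g; split.
- split.
  + by move=> x /(Zbasis_coord bO)[d ->]; rewrite /g linext_zcomb ?bO.1 //; exact: zcomb_mem bO'.
  + by move=> x y _ _; apply: gI.
  + move=> y /(Zbasis_coord bO')[d ->]; exists (zcomb b d); first exact: zcomb_mem bO.
    by rewrite /g linext_zcomb //; exact: bO.1.
(* The multiplication table does not give the coordinates of 1, but [g 1] is a nonzero idempotent of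
   a field. *)
- have g10 : g 1 != 0.
    by rewrite -(linext0 b b') (inj_eq gI) oner_neq0.
  by apply: (mulfI g10); rewrite -gM !mulr1.
- by move=> x y _ _; apply: linextD.
- by move=> x y _ _; apply: gM.
Qed.

Lemma finitely_many_codes (T : finType) (S : numorder -> Prop) (P : numorder -> T -> Prop) :
  (forall O, S O -> exists t, P O t) ->
  (forall O O' t, P O t -> P O' t -> order_iso O O') -> finitely_many_classes S.
Proof.
move=> SP PI; pose A := [set t : T | `[< exists O, P O t >]]%SET.
have AP (i : 'I_#|A|) : exists O, P O (enum_val i).
  by have := enum_valP i; rewrite inE => /asboolP.
exists #|A|, (fun i => projT1 (cid (AP i))) => O SO; have [t Pt] := SP _ SO.
have At : t \in A by rewrite inE; apply/asboolP; exists O.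
exists (enum_rank_in At t); case: cid => O' /=; rewrite enum_rankK_in // => Pt'.
exact: PI Pt' Pt.
Qed.

(* An order is determined by its multiplication table in a reduced basis. *)
Lemma finite_bounded_disc (R : realType) n (X : rat) : finitely_many_classes
  (fun O => \dim {:ofield O} = n /\ abs_disc (oset O) <= X).
Proof.
have [B BP] := structure_constants_bounded R n X.
pose dec (t : {ffun 'I_n * 'I_n * 'I_n -> 'I_(B.*2.+1)}) i j : 'rV[int]_n :=
  \row_k ((t (i, j, k) : nat)%:Z - B%:Z).
apply: (@finitely_many_codes _ _ (fun O t => exists2 b : 'I_n -> ofield O,
    is_Zbasis b (oset O) & forall i j, b i * b j = zcomb b (dec t i j))).
- move=> O [dO OX]; case: O dO OX => K O Oord /= dO OX.
  have [b bO [c [cB cE]]] := BP K O (esym dO) Oord OX.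
  exists [ffun ijk => inord (absz (c ijk.1.1 ijk.1.2 0 ijk.2 + B%:Z)%R)].
  exists b => // i j; rewrite cE; congr zcomb; apply/rowP => k.
  rewrite mxE ffunE /= inordK; first by have := cB i j k; lia.
  by have := cB i j k; lia.
- move=> O O' t [b bO bE] [b' bO' bE']; exact: order_iso_structure bO bO' bE bE'.
Qed.

(** * The flag of an order *)

Section Generators.
Variable K : fieldExtType rat.
Implicit Types (U W : {vspace K}).

Lemma rational_nonroot (r : {poly K}) : r != 0 -> exists t : rat, ~~ root r (in_alg K t).
Proof.
move=> r0; apply: contrapT => h.
pose ts := mkseq (fun k => in_alg K k%:R) (size r).
have : (size ts < size r)%N.
  apply: (max_poly_roots r0).
    by apply/allP => x /mapP[k _ ->]; apply/negPn/negP => hk; apply: h; exists k%:R.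
  rewrite mkseq_uniq // => k m /(fmorph_inj (in_alg K : {rmorphism rat -> K})) /eqP.
  by rewrite eqr_nat => /eqP.
by rewrite size_mkseq ltnn.
Qed.

Lemma rational_minPoly (x : K) : exists2 p : {poly rat},
  separable_poly p & root (map_poly (in_alg K) p) x.
Proof.
have /polyOver1P[p pE] := minPolyOver 1 x.
exists p; last by rewrite -pE root_minPoly.
have : separable_element 1 x by apply: pcharf0_separable; exact: pchar_number_field.
by rewrite /separable_element pE separable_map.
Qed.

Lemma mem_adjoin_horner (p : {poly rat}) (z : K) :
  (map_poly (in_alg K) p).[z] \in <<1; z>>%VS.
Proof.
by apply/Fadjoin_polyP; exists (map_poly (in_alg K) p) => //; apply/polyOver1P; exists p.
Qed.

(* Take v in W outside U with [Q(v) : Q] maximal.  For w in W, some element t w - v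
   lies outside U and generates Q(v, w), so w is in Q(v). *)
Lemma exists_generator U W : ~~ (W <= U)%VS ->
  exists v, [/\ v \in W, v \notin U & (W <= <<1; v>>)%VS].
Proof.
move=> WU; pose P k := `[< exists v, [/\ v \in W, v \notin U & \dim <<1; v>>%VS = k] >].
have exP : exists k, P k.
  have [v vW vU] : exists2 v, v \in W & v \notin U.
    apply: contrapT => h; case/negP: WU; apply/subvP => v vW.
    by apply/negPn/negP => vU; apply: h; exists v.
  by exists (\dim <<1; v>>%VS); apply/asboolP; exists v.
have ubP k : P k -> (k <= \dim {:K})%N.
  by move=> /asboolP[v [_ _ <-]]; rewrite dimvS ?subvf.
case: (ex_maxnP exP ubP) => k /asboolP[v [vW vU vk]] kmax.
exists v; split => //; apply/subvP => w wW.
have [p sp pv] := rational_minPoly v; have [q sq qw] := rational_minPoly w.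
(* Primitive element theorem: for [t] outside the zeros of [r], both [v] and [w] are polynomials in
   [t w - v]. *)
have [r r0 rP] := large_field_PET (separable_poly_neq0 sp) pv qw sq.
have [t tr tU] : exists2 t : rat, ~~ root r (in_alg K t) & in_alg K t * w - v \notin U.
  have [t tr] := rational_nonroot r0.
  (* If [t w - v] falls into [U], a second value [u] cannot do the same: the difference would put
     [w], and then [v], into [U]. *)
  have [bad|good] := boolP (in_alg K t * w - v \in U); last by exists t.
  have r1 : r * ('X - (in_alg K t)%:P) != 0 by rewrite mulf_neq0 // polyXsubC_eq0.
  have [u] := rational_nonroot r1; rewrite rootM root_XsubC negb_or => /andP[ur ut].
  exists u => //; apply/negP => bad'.
  have ut' : u - t != 0 by rewrite subr_eq0; apply: contraNneq ut => ->.
  have wU : w \in U.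
    have -> : w = (u - t)^-1 *: ((in_alg K u * w - v) - (in_alg K t * w - v)).
      by rewrite /= !mulr_algl opprB addrA subrK -scalerBl scalerA mulVf // scale1r.
    by rewrite memvZ // rpredB.
  case/negP: vU; have -> : v = in_alg K t * w - (in_alg K t * w - v).
    by rewrite opprB addrC subrK.
  by rewrite rpredB //= mulr_algl memvZ.
set z := in_alg K t * w - v in tU.
have [[pv' pvE] [pw pwE]] := rP t tr.
have vz : v \in <<1; z>>%VS by rewrite -pvE mem_adjoin_horner.
have wz : w \in <<1; z>>%VS by rewrite -pwE mem_adjoin_horner.
have zW : z \in W by rewrite rpredB //= mulr_algl memvZ.
have vz' : (<<1; v>> <= <<1; z>>)%VS by apply/FadjoinP; rewrite sub1v.
(* By maximality [<<1; z>>] is no larger than the field [<<1; v>>] it contains, so the latter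
   contains [w]. *)
have : (\dim <<1; z>>%VS <= k)%N by apply: kmax; apply/asboolP; exists z.
by rewrite -vk (geq_leqif (dimv_leqif_sup vz')) => /subvP /(_ _ wz).
Qed.

(** [W] lies in Q(v), and Q(v) lies in Q(U), because [v] is in [U]. *)
Lemma gen_field_eq U W v : v \in U -> (U <= W)%VS -> (W <= <<1; v>>)%VS ->
  gen_field [set` U] = gen_field [set` W].
Proof.
move=> vU UW Wv; apply: val_inj => /=; rewrite /gen_field !vspan_vs.
apply/eqP; rewrite eqEsubv agenvS //= -[X in (_ <= X)%VS]agenv_id agenvS //.
apply: subv_trans Wv _; apply: (subv_trans (_ : _ <= agenv (agenv U))%VS); last by rewrite agenv_id.
by rewrite agenvS // subv_add sub1_agenv /= -memvE; apply: (subvP (sub_agenv U)).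
Qed.

End Generators.

Lemma agenv01 (K : fieldExtType rat) : agenv (0%VS : {vspace K}) = 1%VS.
Proof. by rewrite agenvEl prod0v addv0. Qed.

Lemma agenv1 (K : fieldExtType rat) : agenv (1%VS : {vspace K}) = 1%VS.
Proof. by apply/eqP; rewrite eqEsubv sub1_agenv andbT agenv_sub_modl ?prodv1. Qed.

Section OrderFlag.
Variables (K : fieldExtType rat) (R : realType) (d : nat).
Local Notation n := d.+1.
Hypothesis nK : n = \dim {:K}.
Local Notation C := (R[i]).
Variable s : 'I_n -> {rmorphism K -> C}.
Hypothesis sP : embedding_enum s.
Variables (b : 'I_n -> K) (O : set K).
Hypotheses (bO : is_Zbasis b O) (O1 : O 1) (OM : forall x y, O x -> O y -> O (x * y)).
Local Notation N := (embnorm R).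
Local Notation lam := (succ_min R O).
Local Notation V r := (vspan (short O (r : R))).

(* When several minima coincide, the short elements do not determine the flag; the
   condition that F i contains a generator of Q(V (lam i)) keeps the flag from
   producing fields that are not in the tower of O. *)
Lemma adapted_flag : exists F : 'I_n -> {vspace K},
  [/\ is_flag F, forall i, (F i <= V (lam i))%VS &
   forall i : 'I_n, (0 < i)%N ->
     exists2 v, v \in F i & (V (lam i) <= <<1; v>>)%VS].
Proof.
have H k : (k <= n)%N -> exists ws : seq K, [/\ size ws = k, free ws, (0 < k)%N -> ws`_0 = 1,
    forall i, (i < k)%N -> ws`_i \in V (lam i) &
    forall i, (0 < i)%N -> (i < k)%N -> (V (lam i) <= <<1; ws`_i>>)%VS].
  elim: k => [_|k IH kn]; first by exists [::]; rewrite nil_free.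
  have [ws [sws fws ws0 wsP wsG]] := IH (ltnW kn).
  have [x [xV xU x1 xG]] : exists x, [/\ x \in V (lam k), x \notin <<ws>>%VS,
      k = 0%N -> x = 1 & (0 < k)%N -> (V (lam k) <= <<1; x>>)%VS].
    (* The first vector is taken to be 1, so that the flag starts with Q. *)
    have [k0|k0] := posnP k.
      exists 1; split=> //.
        by apply: (mem1_V nK sP O1); apply: (succ_min_ge1 nK sP bO OM).
      by move/eqP: sws; rewrite k0 size_eq0 => /eqP ->; rewrite span_nil memv0 oner_eq0.
    have : ~~ (V (lam k) <= <<ws>>)%VS.
      apply/negP => /dimvS; rewrite (eqnP fws) sws leqNgt; apply/negP/negPn.
      exact: (succ_min_dim nK sP bO OM).
    move/exists_generator => [v [vV vU vG]]; exists v; split=> //.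
    by move=> k00; rewrite k00 in k0.
  exists (rcons ws x); split; first by rewrite size_rcons sws.
  - by rewrite -(perm_free (_ : perm_eq (x :: ws) _)) ?free_cons ?xU // perm_sym perm_rcons.
  - move=> _; rewrite nth_rcons sws; case: posnP => k0; first by rewrite k0 x1.
    by rewrite ws0.
  - move=> i; rewrite ltnS nth_rcons sws leq_eqVlt => /orP[/eqP ->|ik].
      by rewrite ltnn eqxx.
    by rewrite ik; apply: wsP.
  - move=> i i0; rewrite ltnS nth_rcons sws leq_eqVlt => /orP[/eqP ik|ik].
      by rewrite -ik ltnn eqxx ik; apply: xG; rewrite -ik.
    by rewrite ik; apply: wsG.
have [ws [sws fws ws0 wsP wsG]] := H n (leqnn n).
have dF i : (i < n)%N -> \dim <<take i.+1 ws>>%VS = i.+1.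
  move=> ilt; have : free (take i.+1 ws).
    by move: fws; rewrite -{1}(cat_take_drop i.+1 ws) => /catl_free.
  by move/eqnP => ->; rewrite size_takel // sws.
exists (fun i => <<take i.+1 ws>>%VS); split.
- split.
  + rewrite (take_nth 0) ?sws // take0 /= ws0 // span_seq1 //.
  + apply/eqP; rewrite eqEdim subvf dF //= -nK //.
  + move=> i j ij; rewrite -(cat_take_drop i.+1 (take j.+1 ws)) span_cat.
    by rewrite take_takel // addvSl.
  + by move=> i; apply: dF.
- move=> i; apply/span_subvP => x /(nthP 0)[k]; rewrite size_takel ?sws // => ki <-.
  rewrite nth_take //; have kn := leq_trans ki (ltn_ord i).
  apply: (subvP (vspanS _) _ (wsP k kn)); apply: short_mono.
  exact: (succ_min_mono nK sP bO OM).
- move=> i i0; exists (ws`_i); last exact: wsG.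
  by apply: memv_span; rewrite -(nth_take 0 (ltnSn i)) mem_nth // size_takel ?sws.
Qed.

Variable F : 'I_n -> {vspace K}.
Hypotheses (Fflag : is_flag F) (FV : forall i, (F i <= V (lam i))%VS).

Lemma V_minima (r : R) k : 0 < r -> \dim (V r) = k.+1 -> V r = V (lam k).
Proof.
move=> r0 dr; have kn : (k < n)%N by rewrite -dr nK dimvS // subvf.
have lr : lam k <= r by apply: (succ_min_le nK sP bO OM) => //; rewrite dr.
apply/esym/eqP; rewrite eqEdim vspanS /=; last exact: short_mono.
by rewrite dr; apply: (succ_min_dim nK sP bO OM).
Qed.

(** Dimensions force [F k], which lies in [V (lam k)], to fill [V r]. So every nonzero span of short
    elements is a member of the flag, although coinciding minima can make [F i] smaller than
    [V (lam i)]. *)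
Lemma V_flag (r : R) (k : 'I_n) : 0 < r -> \dim (V r) = k.+1 -> V r = F k.
Proof.
move=> r0 dr; have [_ _ _ dF] := Fflag.
apply/esym/eqP; rewrite eqEdim dF dr leqnn andbT (V_minima r0 dr).
exact: FV.
Qed.

(** With [r] the right-hand side, the products of [F i] and [F j] lie in [V r]. Were the minimum on
    the left larger than [r], then [V r] would be a flag member of index below the flag type,
    against its minimality. *)
Lemma flag_type_minima i j :
  lam (flag_type F i j) <= Num.sqrt n%:R * lam i * lam j.
Proof.
have l0 (k : 'I_n) : 1 <= lam k by apply: (succ_min_ge1 nK sP bO OM).
set r := _ * lam j.
have r1 : 1 <= r.
  rewrite /r !mulr_ege1 // -[X in X <= _]sqrtr1; apply: ler_wsqrtr.
  by rewrite ler1n.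
have r0 : 0 < r by apply: lt_le_trans r1.
have prodV : prod_sub (F i) (F j) (V r).
  move=> u v /(subvP (FV i)) uF /(subvP (FV j)) vF; apply: vspan_prod uF vF.
  move=> x y [Ox /= xl] [Oy /= yl]; apply: sub_vspan; split; first exact: OM.
  apply: le_trans (embnormM nK sP x y) _; apply: ler_pM => //.
  - by rewrite mulr_ge0 ?sqrtr_ge0 ?embnorm_ge0.
  - exact: embnorm_ge0.
  - by rewrite ler_wpM2l ?sqrtr_ge0.
rewrite /flag_type; case: arg_minnP.
  by apply/asboolP => u v _ _; have [_ -> _ _] := Fflag; rewrite memvf.
move=> k _ kmin; rewrite leNgt; apply/negP => rk.
have dk : (\dim (V r) <= k)%N.
  rewrite leqNgt; apply/negP => h; move: rk; rewrite ltNge => /negP; apply.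
  exact: (succ_min_le nK sP bO OM).
have dpos : (0 < \dim (V r))%N.
  have := mem1_V nK sP O1 r1; rewrite lt0n dimv_eq0; apply: contraTneq => ->.
  by rewrite memv0 oner_eq0.
have mn : ((\dim (V r)).-1 < n)%N by rewrite prednK // nK dimvS // subvf.
have dm : \dim (V r) = (Ordinal mn).+1 by rewrite /= prednK.
have : (k <= Ordinal mn)%N.
  by apply: kmin; apply/asboolP; rewrite -(V_flag r0 dm).
by rewrite leqNgt /= prednK // dk.
Qed.

Hypothesis FG : forall i : 'I_n, (0 < i)%N ->
     exists2 v, v \in F i & (V (lam i) <= <<1; v>>)%VS.

Lemma flag_order_fields :
  [set gen_field (short O r) | r in [set r : R | 0 < r]] =
  [set gen_field [set` F i] | i in [set: 'I_n]].
Proof.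
have [F0 Ff Fm dF] := Fflag.
have gV (r : R) : gen_field (short O r) = gen_field [set` V r].
  by apply: val_inj; rewrite /= /gen_field vspan_vs.
have FVg (i : 'I_n) : (0 < i)%N -> gen_field [set` F i] = gen_field (short O (lam i)).
  by move=> i0; have [v vF vG] := FG i0; rewrite gV; apply: (gen_field_eq vF).
have g0 (r : R) : r < 1 -> gen_field (short O r) = gen_field [set` F ord0].
  move=> r1; rewrite gV; apply: val_inj; rewrite /= /gen_field !vspan_vs F0 agenv1.
  rewrite (_ : V r = 0%VS) ?agenv01 //; apply/eqP; rewrite -subv0; apply: vspan_sub => x xs.
  by rewrite (short_small nK sP bO OM xs r1) mem0v.
apply/seteqP; split => [_ [r /= r0 <-]|_ [i _ <-]].
- have [r1|r1] := ltP r 1; first by exists ord0; rewrite ?g0.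
  have dpos : (0 < \dim (V r))%N.
    have := mem1_V nK sP O1 r1; rewrite lt0n dimv_eq0; apply: contraTneq => ->.
    by rewrite memv0 oner_eq0.
  have mn : ((\dim (V r)).-1 < n)%N by rewrite prednK // nK dimvS // subvf.
  have dm : \dim (V r) = (Ordinal mn).+1 by rewrite /= prednK.
  by exists (Ordinal mn) => //; rewrite gV -(V_flag r0 dm).
- have [i0|i0] := posnP i.
    (* Index 0 needs a radius below 1, where only 0 is short and the generated field is Q: at
       [lam 0], which is 1, the span may already exceed Q, as for the Gaussian integers. *)
    exists (1 / 2) => /=; first by rewrite divr_gt0.
    have -> : i = ord0 by apply/ord_inj; rewrite i0.
    by rewrite g0 //; lra.
  exists (lam i) => /=; first exact: (succ_min_gt0 nK sP bO OM).
  by rewrite FVg.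
Qed.

End OrderFlag.

(** * Limits of orders *)

Lemma order_Zbasis (K : fieldExtType rat) n (O : set K) : n = \dim {:K} -> is_order O ->
  exists b : 'I_n -> K, is_Zbasis b O.
Proof. by move=> nK [/(Zbasis_function O nK)]. Qed.

Lemma is_order_add (K : fieldExtType rat) (O : set K) x y :
  is_order O -> O x -> O y -> O (x + y).
Proof.
move=> /(order_Zbasis (erefl _))[b bO] /(Zbasis_coord bO)[c ->] /(Zbasis_coord bO)[c' ->].
by rewrite -zcombD; apply: zcomb_mem.
Qed.

Lemma oset_order (O : numorder) : is_order (oset O).
Proof. by case: O. Qed.

Lemma order_iso_sym O O' : order_iso O O' -> order_iso O' O.
Proof.
have [_ o1 oM] := oset_order O; have oD := is_order_add (oset_order O).
case=> g [[gf gi gs] g1 gD gM].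
(* The implication under the existential makes the inverse total, with 0 as dummy value outside
   [oset O']. *)
have hP y : exists x, oset O' y -> oset O x /\ g x = y.
  have [/gs[x Ox <-]|nO] := pselect (oset O' y); first by exists x.
  by exists 0 => /nO.
pose h y := projT1 (cid (hP y)).
have hE y : oset O' y -> oset O (h y) /\ g (h y) = y by rewrite /h; case: cid.
have hg x : oset O x -> h (g x) = x.
  by move=> Ox; have [Oh gh] := hE _ (gf _ Ox); apply: gi; rewrite ?inE.
exists h; split.
- split.
  + by move=> y /hE[].
  + move=> y y' /set_mem /hE[_ yE] /set_mem /hE[_ yE'] hh.
    by rewrite -yE hh yE'.
  + by move=> x Ox; exists (g x); [apply: gf|apply: hg].
- by rewrite -g1 hg.
- move=> x y /hE[Ox xE] /hE[Oy yE].
  by rewrite -{1}xE -{1}yE -gD // hg //; apply: oD.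
- move=> x y /hE[Ox xE] /hE[Oy yE].
  by rewrite -{1}xE -{1}yE -gM // hg //; apply: oM.
Qed.

Lemma order_iso_trans O1 O2 O3 : order_iso O1 O2 -> order_iso O2 O3 -> order_iso O1 O3.
Proof.
case=> g [[gf gi gs] g1 gD gM] [h [[hf hi hs] h1 hD hM]]; exists (h \o g); split.
- split.
  + by move=> x /gf /hf.
  + move=> x y /set_mem Ox /set_mem Oy /= e; apply: gi; rewrite ?inE //.
    by apply: hi => //; rewrite inE; apply: gf.
  + by move=> z /hs[y /gs[x Ox <-] <-]; exists x.
- by rewrite /= g1.
- by move=> x y Ox Oy /=; rewrite gD // hD //; apply: gf.
- by move=> x y Ox Oy /=; rewrite gM // hM //; apply: gf.
Qed.

(** The estimates apply to a representative of an isomorphism class, so the covering is only asked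
    up to isomorphism. *)
Lemma finitely_many_cover (S S1 S2 : numorder -> Prop) :
  finitely_many_classes S1 -> finitely_many_classes S2 ->
  (forall O, S O -> exists O', order_iso O' O /\ (S1 O' \/ S2 O')) ->
  finitely_many_classes S.
Proof.
move=> [N1 [r1 P1]] [N2 [r2 P2]] H.
exists (N1 + N2)%N, (fun i : 'I_(N1 + N2) => match fintype.split i with inl j => r1 j | inr j => r2 j end).
move=> O /H[O' [OO' [/P1[i iO]|/P2[i iO]]]].
  exists (lshift N2 i); have := unsplitK (inl i : 'I_N1 + 'I_N2) => /= ->.
  exact: order_iso_trans iO OO'.
exists (rshift N1 i); have := unsplitK (inr i : 'I_N1 + 'I_N2) => /= ->.
exact: order_iso_trans iO OO'.
Qed.

Lemma ln_prod (R : realType) I (r : seq I) (F : I -> R) :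
  (forall i, 0 < F i) -> ln (\prod_(i <- r) F i) = \sum_(i <- r) ln (F i).
Proof.
move=> F0; have [//] : 0 < \prod_(i <- r) F i /\ ln (\prod_(i <- r) F i) = \sum_(i <- r) ln (F i).
elim: r => [|a r [IH0 IH]]; first by rewrite !big_nil ln1.
by rewrite !big_cons mulr_gt0 // lnM ?posrE // IH.
Qed.

(** * Logarithmic estimates and passage to the limit *)

Section FlagEstimates.
Variables (R : realType) (d : nat).
Local Notation n := d.+1.

(** The vector [row_mx 0 x] of the polytope as a function; its entry 0 stands for the logarithm of
    [lambda_0 = 1]. *)
Definition shifted (y : 'rV[R]_d) (i : 'I_n) : R := (row_mx (0 : 'rV[R]_1) y) 0 i.

Lemma shifted0 y : shifted y ord0 = 0.
Proof.
have -> : (ord0 : 'I_n) = lshift d (0 : 'I_1) by apply: val_inj.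
by rewrite /shifted row_mxEl mxE.
Qed.

Lemma shiftedS y j : shifted y (lift ord0 j) = y 0 j.
Proof.
have -> : (lift ord0 j : 'I_n) = rshift 1 j by apply: val_inj.
by rewrite /shifted row_mxEr.
Qed.

(** The constant [c] is built from constants of the degree alone, so it serves all orders in all
    fields; dividing by [L] makes it an error that vanishes as the discriminant grows. *)
Lemma order_log_estimates (T : seq nat) : exists2 c : R, 0 <= c & forall O : numorder,
  \dim {:ofield O} = n -> order_tower_type R (oset O) T ->
  1 < ratr (abs_disc (oset O)) :> R ->
  let y := log_minima R d O in let L := ln (ratr (abs_disc (oset O)) : R) in
  exists F : 'I_n -> {vspace ofield O}, [/\ is_flag F, flag_tower_type F T,
    `|\sum_j y 0 j - 1 / 2| <= c / L,
    (forall j, 0 <= y 0 j) /\ (forall i j : 'I_d, (i <= j)%N -> y 0 i <= y 0 j)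
  & forall i j, shifted y (flag_type F i j) <= shifted y i + shifted y j + c / L].
Proof.
have [D D0 DP] := reduced_basis R n.
have [A A0 AE] : exists2 A : R, 0 < A & A = n%:R ^+ n * n`!%:R.
  by exists (n%:R ^+ n * n`!%:R); rewrite // mulr_gt0 ?exprn_gt0 ?ltr0n ?fact_gt0.
have sn0 : 0 < Num.sqrt n%:R :> R by rewrite sqrtr_gt0 ltr0n.
(* [A] comes from the discriminant bound by minima, [D] from the reduced basis, [sqrt n] from the
   norm of a product. *)
exists (`|ln A| + `|ln D| + `|ln (Num.sqrt n%:R)|); first by rewrite !addr_ge0.
case=> K O Oord dK OT D1 y L; simpl in dK, OT, D1, L; have nK := esym dK.
have [s sP] : exists s : 'I_n -> {rmorphism K -> R[i]}, embedding_enum s.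
  by rewrite nK; apply: embedding_enum_exists.
have [_ O1 OM] := Oord; have [b0 b0O] := order_Zbasis nK Oord.
have [b bO bP] := DP _ _ _ nK b0O.
pose Del : R := ratr (abs_disc O); rewrite -/Del in D1 bP.
have LE : L = ln Del by [].
have L0 : 0 < L by rewrite LE ln_gt0.
have Del0 : 0 < Del by apply: lt_trans D1.
set lam := succ_min R O.
have l1 i : (i < n)%N -> 1 <= lam i by apply: (succ_min_ge1 nK sP bO OM).
have l0 i : (i < n)%N -> 0 < lam i by move=> ilt; apply: lt_le_trans (l1 _ ilt).
have lam0 : lam 0%N = 1.
  apply/eqP; rewrite eq_le l1 // andbT; apply: (succ_min_le nK sP bO OM) => //.
  rewrite lt0n dimv_eq0; have := mem1_V nK sP O1 (lexx 1).
  by apply: contraTneq => ->; rewrite memv0 oner_eq0.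
have yE i : shifted y i = ln (lam i) / L.
  case: (unliftP ord0 i) => [j ->|->]; last by rewrite shifted0 /= lam0 ln1 mul0r.
  by rewrite shiftedS mxE.
have P0 : 0 < \prod_(i < n) lam i by apply: prodr_gt0 => i _; apply: l0.
set P := \prod_(i < n) lam i in P0.
have sumE : \sum_j y 0 j = ln P / L.
  rewrite /P big_ord_recl lam0 mul1r ln_prod; last by move=> j; apply: l0.
  by rewrite mulr_suml; apply: eq_bigr => j _; rewrite mxE.
have P20 : 0 < P ^+ 2 by rewrite exprn_gt0.
have AP0 : 0 < A * P ^+ 2 by apply: mulr_gt0.
have DD0 : 0 < D * Del by apply: mulr_gt0.
have lP1 : L <= ln A + 2 * ln P.
  have -> : 2 * ln P = ln (P ^+ 2) by rewrite lnXn // mulr_natl.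
  rewrite LE -lnM ?posrE // ler_ln ?posrE //.
  by rewrite AE; exact: (disc_le_minima nK sP bO OM).
have lP2 : 2 * ln P <= ln D + L.
  have -> : 2 * ln P = ln (P ^+ 2) by rewrite lnXn // mulr_natl.
  rewrite LE -lnM ?posrE // ler_ln ?posrE //.
  have bn0 : 0 <= \prod_i embnorm R (b i).
    by apply: prodr_ge0 => i _; apply: embnorm_ge0.
  apply: le_trans bP; rewrite prodrXl ler_pXn2r ?nnegrE ?(ltW P0) //.
  exact: (minima_le_basis nK sP bO OM).
have [F [Fflag FV FG]] := adapted_flag nK sP bO O1 OM.
exists F; split => //.
- by rewrite /flag_tower_type -(flag_order_fields nK sP bO O1 OM Fflag FV FG).
- rewrite sumE; have -> : ln P / L - 1 / 2 = (ln P - L / 2) / L.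
    by rewrite mulrBl [L / 2 / L]mulrAC divff ?gt_eqF.
  rewrite normrM normfV (gtr0_norm L0) ler_pM2r ?invr_gt0 //.
  have := ler_norm (ln A); have := ler_norm (ln D); have := normr_ge0 (ln (Num.sqrt n%:R) : R).
  have := normr_ge0 (ln D); have := normr_ge0 (ln A).
  by rewrite ler_norml; move: lP1 lP2; clear; lra.
- split=> [j|i j ij]; rewrite -!shiftedS !yE.
    by rewrite divr_ge0 ?(ltW L0) // ln_ge0 // l1.
  rewrite ler_pM2r ?invr_gt0 // ler_ln ?posrE ?l0 //.
  exact: (succ_min_mono nK sP bO OM).
- move=> i j; rewrite !yE -!mulrDl ler_pM2r ?invr_gt0 //.
  have h := flag_type_minima nK sP bO O1 OM Fflag FV i j.
  have : ln (lam (flag_type F i j)) <= ln (Num.sqrt n%:R * lam i * lam j).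
    by rewrite ler_ln ?posrE ?mulr_gt0 ?l0.
  rewrite !lnM ?posrE ?mulr_gt0 ?l0 //.
  have := ler_norm (ln (Num.sqrt n%:R) : R); have := normr_ge0 (ln D); have := normr_ge0 (ln A).
  by clear; lra.
Qed.

Lemma Spe_sub_polytopes (T : seq nat) (C : fieldExtType rat -> Prop) (x : 'rV[R]_d) :
  (forall K, C K -> \dim {:K} = n) ->
  Spe (fun O => exists K, C K /\ orders_of_type R T K O) x ->
  exists (K : fieldExtType rat) (F : 'I_n -> {vspace K}),
    [/\ C K, is_flag F, flag_tower_type F T & polytope (flag_type F) x].
Proof.
move=> Cd [S [Siso SS [Sinf Sx]]].
have [c c0 cP] := order_log_estimates T.
pose good e (O : numorder) := let y := log_minima R d O in
  [/\ C (ofield O), forall j, `|y 0 j - x 0 j| < e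
   & exists F : 'I_n -> {vspace ofield O}, [/\ is_flag F, flag_tower_type F T,
    `|\sum_j y 0 j - 1 / 2| <= e,
    (forall j, 0 <= y 0 j) /\ (forall i j : 'I_d, (i <= j)%N -> y 0 i <= y 0 j)
  & forall i j, shifted y (flag_type F i j) <= shifted y i + shifted y j + e]].
(* Otherwise each class in [S] would have a representative that is far from [x] or of discriminant
   at most [X]; both kinds form finitely many classes, but [S] has infinitely many. *)
have goodE e : 0 < e -> exists O, good e O.
  move=> e0; apply: contrapT => nog; apply: Sinf.
  (* For discriminants beyond [X] the error [c / L] is at most [e]. *)
  pose X : rat := (Num.truncn (expR (c / e))).+1%:R.
  apply: (finitely_many_cover (Sx e e0) (finite_bounded_disc R n X)) => O SO.
  have [K [CK [A [hA [AT AO]]]]] := SS _ SO.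
  exists (NumOrder hA); split => //.
  have [far|near] := pselect (~ (forall j, `|log_minima R d (NumOrder hA) 0 j - x 0 j| < e)).
    left; split=> //; exact: Siso (order_iso_sym AO) SO.
  right; split; first exact: Cd.
  rewrite leNgt; apply/negP => XD; apply: nog; exists (NumOrder hA).
  have XD' : expR (c / e) < ratr (abs_disc A).
    apply: lt_trans (_ : ratr X < _); last by rewrite ltr_rat.
    by rewrite /X ratr_nat truncnS_gt.
  have D1 : 1 < ratr (abs_disc A) :> R.
    by apply: le_lt_trans XD'; rewrite -expR0 ler_expR divr_ge0 // ltW.
  have [F [F1 F2 F3 F4 F5]] := cP (NumOrder hA) (Cd _ CK) AT D1.
  have L0 : 0 < ln (ratr (abs_disc A) : R) by rewrite ln_gt0.
  have ce : c / ln (ratr (abs_disc A)) <= e.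
    rewrite ler_pdivrMr // mulrC -ler_pdivrMr // -(expRK (c / e)) ler_ln ?posrE ?expR_gt0 //.
      exact: ltW.
    by apply: lt_trans D1.
  split => //; first exact: contrapT.
  exists F; split => //; first exact: le_trans ce.
  by move=> i j; apply: le_trans (F5 i j) _; rewrite lerD2l.
pose goodt e (t : {ffun 'I_n * 'I_n -> 'I_n}) (O : numorder) := let y := log_minima R d O in
  [/\ C (ofield O), forall j, `|y 0 j - x 0 j| < e
   & exists F : 'I_n -> {vspace ofield O}, [/\ is_flag F, flag_tower_type F T,
     forall i j, flag_type F i j = t (i, j)
    & [/\ `|\sum_j y 0 j - 1 / 2| <= e,
    (forall j, 0 <= y 0 j), (forall i j : 'I_d, (i <= j)%N -> y 0 i <= y 0 j)
  & forall i j, shifted y (t (i, j)) <= shifted y i + shifted y j + e]]].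
(* Pigeonhole over the finitely many flag types: if each type failed at some error, an order that is
   good for the smallest of these errors would contradict the failure of its own type. *)
have [t tP] : exists t, forall e, 0 < e -> exists O, goodt e t O.
  apply: contrapT => not.
  have eP t : exists e, 0 < e /\ ~ exists O, goodt e t O.
    apply: contrapT => h; apply: not; exists t => e e0.
    by apply: contrapT => h'; apply: h; exists e.
  pose et t := projT1 (cid (eP t)).
  have et0 t : 0 < et t by rewrite /et; case: cid => ? [].
  have etN t : ~ exists O, goodt (et t) t O by rewrite /et; case: cid => ? [].
  pose e := \big[Num.min/1]_t et t.
  have e0 : 0 < e by rewrite /e; apply/bigmin_gtP; split.
  have [O [CO near [F [F1 F2 F3 [F4 F4'] F5]]]] := goodE e e0.
  pose t := [ffun ij : 'I_n * 'I_n => flag_type F ij.1 ij.2].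
  have ee : e <= et t by apply: bigmin_le_cond.
  apply: (etN t); exists O; split => //.
    by move=> j; apply: lt_le_trans (near j) ee.
  exists F; split => //; first by move=> i j; rewrite ffunE.
  split => //; first exact: le_trans ee.
  by move=> i j; rewrite ffunE; apply: le_trans (F5 i j) _; rewrite lerD2l.
(* The polytope sees a flag only through its type, so any one order of type [t] supplies field and
   flag; the inequalities come from orders of ever smaller error. *)
have [O [CO _ [F [F1 F2 Ft _]]]] := tP 1 ltr01.
exists (ofield O), F; split=> //.
have near e (e0 : 0 < e) (O' : numorder) (h : forall j, `|log_minima R d O' 0 j - x 0 j| < e) (i : 'I_n) :
    `|shifted (log_minima R d O') i - shifted x i| <= e.
  case: (unliftP ord0 i) => [j ->|->]; last by rewrite !shifted0 subrr normr0 ltW.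
  by rewrite !shiftedS ltW.
split.
- apply/eqP; rewrite -subr_eq0 -normr_le0; apply/ler_addgt0Pr => e e0; rewrite add0r.
  have e'0 : 0 < e / n%:R by rewrite divr_gt0 // ltr0n.
  have [O' [_ nO [F' [_ _ _ [sO _ _ _]]]]] := tP _ e'0.
  rewrite (_ : _ - _ = (\sum_j log_minima R d O' 0 j - 1 / 2)
      - \sum_j (log_minima R d O' 0 j - x 0 j)); last first.
    by rewrite sumrB; ring.
  apply: le_trans (ler_normB _ _) _.
  have -> : e = e / n%:R + \sum_(j < d) e / n%:R.
    by rewrite sumr_const card_ord -mulrS -[RHS]mulr_natr divfK // pnatr_eq0.
  apply: lerD => //; apply: le_trans (ler_norm_sum _ _ _) _; apply: ler_sum => j _.
  exact: ltW.
- move=> j; apply/ler_addgt0Pr => e e0; have [O' [_ nO [F' [_ _ _ [_ pO _ _]]]]] := tP _ e0.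
  by have := pO j; have := nO j; rewrite ltr_norml => /andP[h1 h2] h3; move: h1 h2 h3; clear; lra.
- move=> i j ij; apply/ler_addgt0Pr => e e0.
  have e20 : 0 < e / 2 by rewrite divr_gt0.
  have [O' [_ nO [F' [_ _ _ [_ _ mO _]]]]] := tP _ e20.
  have := mO i j ij; have := nO i; have := nO j; rewrite !ltr_norml => /andP[h1 h2] /andP[h3 h4] h5.
  by move: h1 h2 h3 h4 h5; clear; lra.
- move=> i j _ _; rewrite -/(shifted x _) -/(shifted x i) -/(shifted x j) Ft.
  apply/ler_addgt0Pr => e e0.
  have e40 : 0 < e / 4 by rewrite divr_gt0.
  have [O' [_ nO [F' [_ _ _ [_ _ _ tO]]]]] := tP _ e40.
  have := tO i j; have := near _ e40 O' nO (t (i, j)); have := near _ e40 O' nO i; have := near _ e40 O' nO j.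
  rewrite !ler_norml => /andP[h1 h2] /andP[h3 h4] /andP[h5 h6] h7.
  by move: h1 h2 h3 h4 h5 h6 h7; clear; lra.
Qed.

End FlagEstimates.

(** * Invariance under isomorphism *)

(** [K] has exactly [n] embeddings, so an injective family of [n] of them is complete. *)
Lemma embedding_enum_inj (K : fieldExtType rat) (R : realType) n
    (s : 'I_n -> {rmorphism K -> R[i]}) :
  n = \dim {:K} -> injective (fun m => s m : K -> R[i]) -> embedding_enum s.
Proof.
move=> nK sI; split => // e.
have [s0 [_ s0P]] : exists s0 : 'I_n -> {rmorphism K -> R[i]}, embedding_enum s0.
  by subst n; apply: embedding_enum_exists.
pose p m := projT1 (cid (s0P (s m))).
have pE m : (s m : K -> R[i]) = s0 (p m) by rewrite /p; case: cid.
have pI : injective p by move=> m m' mm; apply: sI; rewrite !pE mm.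
have [k ->] := s0P e; exists (invF pI k); rewrite pE; congr (s0 _ : K -> R[i]).
by rewrite f_invF.
Qed.

Section IsoInvariance.
Variables (K K' : fieldExtType rat) (R : realType) (n : nat).
Variables (e : {rmorphism K -> K'}) (b : 'I_n -> K) (O : set K) (O' : set K').
Hypotheses (bO : is_Zbasis b O) (bO' : is_Zbasis (e \o b) O').

Let eZ (a : rat) x : e (a *: x) = a *: e x.
Proof. exact: (rat_linear (raddfB e)). Qed.

Let nK : n = \dim {:K} := is_basis_dim bO.1.
Let nK' : n = \dim {:K'} := is_basis_dim bO'.1.

Let e_zcomb c : e (zcomb b c) = zcomb (e \o b) c.
Proof. by rewrite /zcomb rmorph_sum; apply: eq_bigr => i _; rewrite rmorphMz. Qed.

Let e_surj y : exists x, e x = y.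
Proof.
exists (\sum_i qcoord (e \o b) i y *: b i).
by rewrite [RHS](is_basis_sum y bO'.1) rmorph_sum; apply: eq_bigr => i _; rewrite eZ.
Qed.

Let O'E : O' = e @` O.
Proof.
apply/seteqP; split => [y /(Zbasis_coord bO')[c ->]|_ [x /(Zbasis_coord bO)[c ->] <-]].
  by exists (zcomb b c); [exact: zcomb_mem bO | exact: e_zcomb].
by rewrite e_zcomb; exact: zcomb_mem bO'.
Qed.

Variable s' : 'I_n -> {rmorphism K' -> R[i]}.
Hypothesis sP' : embedding_enum s'.

Let s m : {rmorphism K -> R[i]} := s' m \o e.

Let sP : embedding_enum s.
Proof.
apply: embedding_enum_inj => // m m' mm; apply: sP'.1; apply/funext => y.
by have [x <-] := e_surj y; have := congr1 (fun f => f x) mm.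
Qed.

(** The embeddings of [K] are those of [K'] composed with [e], so both norms are the same sum. *)
Lemma embnorm_iso x : embnorm R (e x) = embnorm R x.
Proof. by rewrite (embnormE nK sP) (embnormE nK' sP'). Qed.

Lemma short_iso (r : R) : short O' r = e @` short O r.
Proof.
rewrite O'E; apply/seteqP; split => [_ [[x Ox <-] /= xr]|_ [x [Ox /= xr] <-]].
  by exists x => //; split => //=; rewrite -embnorm_iso.
by split; [exists x | rewrite /= embnorm_iso].
Qed.

Lemma dim_vspan_iso (A : set K) : \dim (vspan (e @` A)) = \dim (vspan A).
Proof.
have eL : linear e by move=> a x y; rewrite rmorphD eZ.
pose fL := GRing.isLinear.Build rat K K' *:%R e eL.
pose F : {linear K -> K'} := HB.pack (e : K -> K') fL.
have FE : linfun F =1 e by move=> x; rewrite lfunE.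
have <- : (linfun F @: vspan A)%VS = vspan (e @` A).
  apply/eqP; rewrite eqEsubv; apply/andP; split.
    apply/subvP => _ /memv_imgP[x xA ->].
    have : (vspan A <= linfun F @^-1: vspan (e @` A))%VS.
      by apply: vspan_sub => u uA; rewrite -memv_preim FE; apply: sub_vspan; exists u.
    by move/subvP/(_ _ xA); rewrite -memv_preim.
  apply: vspan_sub => _ [x Ax <-]; rewrite -FE memv_img //; exact: sub_vspan.
apply: limg_dim_eq; apply/eqP; rewrite -subv0; apply/subvP => x.
by rewrite memv_cap memv_ker FE fmorph_eq0 memv0 => /andP[].
Qed.

Lemma succ_min_iso i : succ_min R O' i = succ_min R O i.
Proof.
congr minimum; apply/seteqP; split => r /= [r0]; rewrite short_iso dim_vspan_iso;
  by split.
Qed.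

Lemma abs_disc_iso : abs_disc O' = abs_disc O.
Proof.
rewrite (abs_disc_basis R bO) (abs_disc_basis R bO'); congr `|_|.
apply: (fmorph_inj (ratr : {rmorphism rat -> R[i]})) => /=.
rewrite (basis_disc_embmx nK sP) (basis_disc_embmx nK' sP'); congr (\det _ ^+ 2).
Qed.

End IsoInvariance.

(** The Q-linear extension from a Z-basis is multiplicative, hence a morphism of fields, and its
    injectivity makes the image of the Z-basis independent. *)
Lemma order_iso_extend (O O' : numorder) n (b : 'I_n -> ofield O) : order_iso O O' ->
  is_Zbasis b (oset O) ->
  exists e : {rmorphism ofield O -> ofield O'}, is_Zbasis (e \o b) (oset O').
Proof.
case=> g [[gf gi gs] g1 gD gM] bO; have nK := is_basis_dim bO.1.
have [_ o1 oM] := oset_order O; have [[t [tb OtE]] _ _] := oset_order O'.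
(* [g] is additive only on [oset O]; composed with [zcomb b] it is additive on all integer
   vectors. *)
pose h (c : 'rV[int]_n) := g (zcomb b c).
have hD c c' : h (c + c') = h c + h c'.
  by rewrite /h zcombD gD //; exact: zcomb_mem bO.
have h0 : h 0 = 0 by apply: (addrI (h 0)); rewrite -hD !addr0.
have hB : zmod_morphism h.
  by move=> c c'; apply: (addIr (h c')); rewrite subrK -hD subrK.
pose hA := GRing.isZmodMorphism.Build _ _ h hB.
pose H : {additive 'rV[int]_n -> ofield O'} := HB.pack h hA.
pose b' i := g (b i).
have hE c : h c = zcomb b' c.
  rewrite {1}(row_sum_delta c) -[h]/(H : _ -> _) raddf_sum; apply: eq_bigr => i _.
  by rewrite -[c 0 i in LHS]intz scaler_int raddfMz /= /h zcomb_delta.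
have lE x : oset O x -> linext b b' x = g x.
  by move=> /(Zbasis_coord bO)[c ->]; rewrite linext_zcomb; [rewrite -hE | exact: bO.1].
have [e eE] : exists e : {rmorphism ofield O -> ofield O'}, (e : _ -> _) = linext b b'.
  apply: linext_rmorph; first exact: bO.1.
    move=> i j; have [bi bj] := (mem_Zbasis i bO, mem_Zbasis j bO).
    by rewrite lE ?gM //; apply: oM.
  by rewrite lE.
have eb : e \o b = b' by apply/funext => i; rewrite /= eE linext_basis //; exact: bO.1.
exists e; rewrite eb.
have OE : oset O' = range (zcomb b').
  apply/seteqP; split => [y /gs[x Ox <-]|_ [c _ <-]].
    by have [c ->] := Zbasis_coord bO Ox; exists c => //; rewrite -hE.
  by rewrite -hE; apply: gf; exact: zcomb_mem bO.
split => //; rewrite /is_basis /basis_of; apply/andP; split.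
  rewrite eqEsubv subvf /= -(span_basis tb); apply/span_subvP => y yt.
  have [i ilt <-] := nthP 0 yt; rewrite size_tuple in ilt.
  have : oset O' t`_i.
    rewrite OtE; exists (fun j => (j == Ordinal ilt)%:Z).
    rewrite (bigD1 (Ordinal ilt)) //= eqxx big1 ?addr0 //.
    by move=> j /negbTE ->.
  rewrite OE => -[c _ <-]; rewrite zcombE; apply: memv_suml => j _; apply: memvZ.
  by apply: memv_span; rewrite -(mktuple_nth b') mem_nth ?size_tuple.
apply/freeP => k k0 i.
have : e (\sum_i k i *: b i) = 0.
  rewrite eE linext_sum -[RHS]k0; apply: eq_bigr => j _.
  by rewrite linextZ linext_basis ?mktuple_nth //; exact: bO.1.
move/eqP; rewrite fmorph_eq0 => /eqP kb; rewrite -(qcoord_sum k i bO.1) kb.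
by rewrite /qcoord linear0.
Qed.

Lemma order_iso_invariants (R : realType) (O O' : numorder) : order_iso O O' ->
  (forall i, succ_min R (oset O') i = succ_min R (oset O) i) /\
  abs_disc (oset O') = abs_disc (oset O).
Proof.
move=> OO'; have [b bO] := order_Zbasis (erefl _) (oset_order O).
have [e eP] := order_iso_extend OO' bO; have nK' := is_basis_dim eP.1.
have [s' sP'] : exists s' : 'I_(\dim {:ofield O}) -> {rmorphism ofield O' -> R[i]}, embedding_enum s'.
  by rewrite nK'; apply: embedding_enum_exists.
split=> [i|]; first exact: succ_min_iso bO eP s' sP' i.
exact: abs_disc_iso bO eP s' sP'.
Qed.

(** * The order of a flag *)

Section AdaptedBasis.
Variables (K : fieldExtType rat) (d : nat).
Local Notation n := d.+1.
Hypothesis nK : n = \dim {:K}.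
Variable F : 'I_n -> {vspace K}.
Hypothesis Fflag : is_flag F.

(** Equivalently, [b_0, ..., b_i] is a basis of [F i]; vanishing coordinates are the form suited to
    rescaling and to products. *)
Definition adapted (b : 'I_n -> K) :=
  [/\ is_basis b, b ord0 = 1 &
   forall i x, x \in F i <-> forall k : 'I_n, (i < k)%N -> qcoord b k x = 0].

Lemma adapted_basis : exists b, adapted b.
Proof.
have [F0 Fmax Fm dF] := Fflag.
have H k : (k <= n)%N -> exists ws : seq K, [/\ size ws = k, (0 < k)%N -> ws`_0 = 1 &
    forall i : 'I_n, (i < k)%N -> <<take i.+1 ws>>%VS = F i].
  elim: k => [_|k IH kn]; first by exists [::].
  have [ws [sws ws0 wsF]] := IH (ltnW kn).
  have [k0|k0] := posnP k.
    exists [:: 1]; split => //; first by rewrite k0.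
    move=> i; rewrite k0 ltnS leqn0 => /eqP i0; rewrite i0 /= span_seq1.
    by have -> : i = ord0 by apply/ord_inj; rewrite i0.
  have k1n : (k.-1 < n)%N by rewrite prednK // ltnW.
  have wsE : <<ws>>%VS = F (Ordinal k1n).
    by rewrite -wsF /= prednK // take_oversize // sws.
  have [x xF xN] : exists2 x, x \in F (Ordinal kn) & x \notin <<ws>>%VS.
    apply: contrapT => h; have : (F (Ordinal kn) <= <<ws>>)%VS.
      by apply/subvP => x xF; apply/negPn/negP => xN; apply: h; exists x.
    by move/dimvS; rewrite wsE !dF /= prednK // ltnn.
  exists (rcons ws x); split; first by rewrite size_rcons sws.
    by move=> _; rewrite nth_rcons sws k0 ws0.
  move=> i; rewrite ltnS leq_eqVlt => /orP[/eqP ik|ik]; last first.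
    by rewrite -cats1 takel_cat ?sws // wsF.
  have -> : i = Ordinal kn by apply: val_inj.
  rewrite take_oversize ?size_rcons ?sws //= -cats1 span_cat span_seq1.
  apply/eqP; rewrite eqEdim subv_add wsE Fm //=; last by rewrite leq_pred.
  rewrite -memvE xF /= dF /= -wsE.
  have dxw : (<<ws>> :&: <[x]> = 0)%VS.
    apply/eqP; rewrite -subv0; apply/subvP => y; rewrite memv_cap memv0 => /andP[yw /vlineP[a ya]].
    apply/negPn/negP => y0; case/negP: xN; move: y0 yw; rewrite ya scaler_eq0 negb_or.
    move=> /andP[a0 _] axw; rewrite -[x]scale1r -(mulVf a0) -scalerA memvZ //.
  rewrite dimv_disjoint_sum // wsE dF /= prednK // dim_vline.
  have -> : x != 0 by apply: contraNneq xN => ->; apply: mem0v.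
  by rewrite addn1.
have [ws [sws ws0 wsF]] := H n (leqnn n).
pose b (i : 'I_n) := ws`_i.
have bE : [tuple b i | i < n] = ws :> seq K.
  apply: (@eq_from_nth _ 0); rewrite ?size_tuple // => i ilt.
  by rewrite (mktuple_nth b (Ordinal ilt)).
have bb : is_basis b.
  rewrite /is_basis basisEdim size_tuple -nK leqnn andbT bE.
  by rewrite -Fmax -wsF //= take_oversize // sws.
exists b; split; [exact: bb | exact: ws0 |] => i x; split.
  rewrite -wsF // => xw k ik.
  rewrite (coord_span (X := in_tuple _) xw) /qcoord linear_sum big1 // => j _.
  have jlt : (j < i.+1)%N by apply: leq_trans (ltn_ord j) _; rewrite size_take_min geq_minl.
  rewrite linearZ /= nth_take //.
  have jn : (j < n)%N by apply: leq_trans jlt (ltn_ord i).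
  rewrite -[ws`_j]/(b (Ordinal jn)) -/(qcoord b k _) qcoord_delta //.
  rewrite (_ : _ == k = false) ?mulr0 //; apply/negbTE/eqP => jk.
  by move: ik; rewrite -jk /= ltnNge -ltnS jlt.
move=> h; rewrite (is_basis_sum x bb); apply: memv_suml => k _.
have [ki|ik] := leqP k i; last by rewrite h // scale0r mem0v.
apply: memvZ; rewrite -wsF //; apply: memv_span; rewrite -[b k]/(ws`_k) -(nth_take 0 (ki : (k < i.+1)%N)).
by rewrite mem_nth // size_takel // sws.
Qed.

Lemma qcoord_scale (b : 'I_n -> K) (a : 'I_n -> rat) k x : is_basis b ->
  (forall i, a i != 0) -> is_basis (fun i => a i *: b i) ->
  qcoord (fun i => a i *: b i) k x = (a k)^-1 * qcoord b k x.
Proof.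
move=> bb a0 ab; rewrite {1}(is_basis_sum x bb).
rewrite -(qcoord_sum (fun k => (a k)^-1 * qcoord b k x) k ab); congr qcoord.
by apply: eq_bigr => i _; rewrite scalerA mulrAC mulVf // mul1r.
Qed.

Lemma is_basis_scale (b : 'I_n -> K) (a : 'I_n -> rat) : is_basis b ->
  (forall i, a i != 0) -> is_basis (fun i => a i *: b i).
Proof.
move=> bb a0; apply: is_basis_span => // x.
exists (fun i => (a i)^-1 * qcoord b i x); rewrite {1}(is_basis_sum x bb).
by apply: eq_bigr => i _; rewrite scalerA mulrAC mulVf // mul1r.
Qed.

Lemma adapted_scale (b : 'I_n -> K) (a : 'I_n -> rat) : adapted b ->
  (forall i, a i != 0) -> a ord0 = 1 -> adapted (fun i => a i *: b i).
Proof.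
case=> bb b0 bF a0 a1; have ab := is_basis_scale bb a0; split => //.
  by rewrite a1 b0 scale1r.
move=> i x; rewrite bF; split => h k ik.
  by rewrite qcoord_scale // h // mulr0.
have := h k ik; rewrite qcoord_scale // => /eqP.
by rewrite mulf_eq0 invr_eq0 (negbTE (a0 k)) => /eqP.
Qed.

(** [b i] and [b j] lie in [F i] and [F j], so their product lies in the flag member indexed by the
    flag type. *)
Lemma adapted_structure (b : 'I_n -> K) : adapted b ->
  forall i j k : 'I_n, (flag_type F i j < k)%N -> qcoord b k (b i * b j) = 0.
Proof.
case=> bb b0 bF i j k; rewrite /flag_type; case: arg_minnP.
  by have [_ -> _ _] := Fflag; apply/asboolP => u v _ _; rewrite memvf.
move=> t /asboolP tP _ tk; apply: (bF t _).1 tk; apply: tP.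
  by apply/bF => l il; rewrite qcoord_delta //; case: eqP il => // ->; rewrite ltnn.
by apply/bF => l il; rewrite qcoord_delta //; case: eqP il => // ->; rewrite ltnn.
Qed.

Definition integral_basis (b : 'I_n -> K) :=
  forall i j k, qcoord b k (b i * b j) \is a Num.int.

(** All vectors except [b ord0 = 1] are multiplied by a common denominator [N] of the structure
    constants [c]; for positive [i] and [j] these become [N c] or, at [k = 0], [N^2 c]. *)
Lemma adapted_integral_basis : exists2 b, adapted b & integral_basis b.
Proof.
have [b bA] := adapted_basis; have [bb b0 bF] := bA.
pose c i j k := qcoord b k (b i * b j).
pose N : rat := (\prod_(t : 'I_n * 'I_n * 'I_n) denq (c t.1.1 t.1.2 t.2))%:~R.
have N0 : N != 0.
  by rewrite intr_eq0; apply/prodf_neq0 => t _; apply: denq_neq0.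
have NZ i j k : N * c i j k \is a Num.int.
  rewrite /N (bigD1 (i, j, k)) //= rmorphM /= mulrAC [_ * c i j k]mulrC -numqE.
  by rewrite rpredM ?intr_int.
pose a (i : 'I_n) : rat := if i == ord0 then 1 else N.
have a0 i : a i != 0 by rewrite /a; case: ifP.
have aZ i : a i \is a Num.int by rewrite /a; case: ifP => _; rewrite ?rpred1 ?intr_int.
have a1 : a ord0 = 1 by rewrite /a eqxx.
have abb := is_basis_scale bb a0.
exists (fun i => a i *: b i); first exact: adapted_scale.
move=> i j k.
have unit_l (j' : 'I_n) : qcoord (fun i => a i *: b i) k (a j' *: b j') \is a Num.int.
  by rewrite (qcoord_delta k j' abb); case: (_ == _); rewrite ?rpred0 ?rpred1.
have [->|i0] := eqVneq i ord0; first by rewrite a1 scale1r b0 mul1r.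
have [->|j0] := eqVneq j ord0; first by rewrite a1 scale1r b0 mulr1.
rewrite qcoord_scale // -scalerAl -scalerAr scalerA.
have -> : qcoord b k ((a i * a j) *: (b i * b j)) = a i * a j * c i j k.
  by rewrite /c /qcoord linearZ.
have -> : a i = N by rewrite /a (negbTE i0).
have -> : a j = N by rewrite /a (negbTE j0).
rewrite /a; case: ifP => _.
  by rewrite invr1 mul1r -mulrA rpredM // intr_int.
by rewrite -mulrA mulKf.
Qed.

Lemma integral_zcomb (b : 'I_n -> K) x : is_basis b ->
  (forall k, qcoord b k x \is a Num.int) -> exists c, x = zcomb b c.
Proof.
move=> bb xZ; exists (\row_k Num.floor (qcoord b k x)).
rewrite zcombE {1}(is_basis_sum x bb); apply: eq_bigr => i _; rewrite mxE.
by have := xZ i; rewrite intrEfloor => /eqP ->.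
Qed.

Lemma lattice_is_order (w : 'I_n -> K) : is_basis w -> w ord0 = 1 ->
  (forall i j k, qcoord w k (w i * w j) \is a Num.int) -> is_order (range (zcomb w)).
Proof.
move=> ww w0 wZ; have wO : is_Zbasis w (range (zcomb w)) by [].
split; first by apply/(Zbasis_function _ nK); exists w.
  by rewrite -w0; exact: mem_Zbasis wO.
move=> _ _ [c _ <-] [c' _ <-].
suff [e ->] : exists e, zcomb w c * zcomb w c' = zcomb w e by exists e.
apply: integral_zcomb => // k; rewrite !zcombE mulr_suml /qcoord linear_sum.
apply: rpred_sum => i _; rewrite mulr_sumr linear_sum; apply: rpred_sum => j _.
rewrite -scalerAl -scalerAr !linearZ /=; do 2 (apply: rpredM; first exact: intr_int).
exact: wZ.
Qed.

Variable b : 'I_n -> K.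
Hypotheses (bA : adapted b) (bZ : integral_basis b).
Variable a : 'I_n -> nat.
Hypotheses (a0 : a ord0 = 0%N) (am : forall i j : 'I_n, (i <= j)%N -> (a i <= a j)%N)
  (at_ : forall i j : 'I_n, (0 < i)%N -> (0 < j)%N -> (a (flag_type F i j) <= a i + a j)%N).

Definition stretch (i : 'I_n) : K := (2 ^+ a i : rat) *: b i.

Lemma pow2_neq0 (i : 'I_n) : 2 ^+ a i != 0 :> rat.
Proof. by rewrite expf_neq0. Qed.

Lemma adapted_stretch : adapted stretch.
Proof. by apply: adapted_scale pow2_neq0 _ => //; rewrite a0. Qed.

(** Rescaling multiplies a structure constant by [2^(a_i + a_j - a_k)]. The constant vanishes for
    [k] beyond the flag type, and up to it [a_k <= a_i + a_j] by monotonicity. *)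
Lemma stretch_order : is_order (range (zcomb stretch)).
Proof.
have [ww w0 _] := adapted_stretch; apply: lattice_is_order => // i j k.
have unit_l (j' : 'I_n) : qcoord stretch k (stretch j') \is a Num.int.
  by rewrite (qcoord_delta k j' ww); case: (_ == _); rewrite ?rpred0 ?rpred1.
have [i0|i0] := posnP i; first by have -> : i = ord0 by [apply/ord_inj]; rewrite w0 mul1r.
have [j0|j0] := posnP j; first by have -> : j = ord0 by [apply/ord_inj]; rewrite w0 mulr1.
rewrite /stretch qcoord_scale //; [|by case: bA|exact: pow2_neq0].
have -> : qcoord b k ((2 ^+ a i : rat) *: b i * ((2 ^+ a j : rat) *: b j)) =
    2 ^+ (a i + a j) * qcoord b k (b i * b j).
  by rewrite -scalerAl -scalerAr scalerA -exprD /qcoord linearZ.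
have [tk|kt] := ltnP (flag_type F i j) k.
  by rewrite adapted_structure // !mulr0.
have le : (a k <= a i + a j)%N := leq_trans (am kt) (at_ i0 j0).
rewrite -(subnKC le) exprD -mulrA mulKf ?pow2_neq0 // rpredM ?bZ //.
by rewrite rpredX // rpred_nat.
Qed.

End AdaptedBasis.

(** * Short elements and minima of the stretched order *)

Section StretchedOrder.
Variables (K : fieldExtType rat) (R : realType) (d : nat).
Local Notation n := d.+1.
Hypothesis nK : n = \dim {:K}.
Variable s : 'I_n -> {rmorphism K -> R[i]}.
Hypothesis sP : embedding_enum s.
Variable F : 'I_n -> {vspace K}.
Hypothesis Fflag : is_flag F.
Variable b : 'I_n -> K.
Hypotheses (bA : adapted F b) (bZ : integral_basis b).
Local Notation N := (embnorm R).

(** Bounds coordinates in [b] by the norm. The summand 1 makes it at most its own square, which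
    avoids square roots of inverse Gram entries. *)
Definition coord_const : R := 1 + \sum_k `|invmx (gram s b) k k|.
Definition norm_const : R := 1 + \sum_k N (b k).

Lemma coord_const_ge1 : 1 <= coord_const.
Proof. by rewrite lerDl sumr_ge0. Qed.

Lemma norm_const_ge1 : 1 <= norm_const.
Proof. by rewrite lerDl sumr_ge0 // => i _; apply: embnorm_ge0. Qed.

Variables (g : nat) (a : 'I_n -> nat).
Hypothesis gP : coord_const * norm_const < 2 ^+ g.
Hypotheses (a0 : a ord0 = 0%N) (am : forall i j : 'I_n, (i <= j)%N -> (a i <= a j)%N)
  (at_ : forall i j : 'I_n, (0 < i)%N -> (0 < j)%N -> (a (flag_type F i j) <= a i + a j)%N)
  (ag : forall i j : 'I_n, (i < j)%N -> (a i + g <= a j)%N).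

Local Notation w := (stretch b a).
Local Notation O := (range (zcomb (stretch b a))).
Local Notation V r := (vspan (short O (r : R))).
Local Notation lam := (succ_min R O).

Let bb : is_basis b. Proof. by case: bA. Qed.
Let wA : adapted F w := adapted_stretch nK bA a0.
Let ww : is_basis w. Proof. by case: wA. Qed.
Let wO : is_Zbasis w O. Proof. by []. Qed.
Let Oord : is_order O := stretch_order nK Fflag bA bZ a0 am at_.
Let O1 : O 1. Proof. by case: Oord. Qed.
Let OM : forall x y, O x -> O y -> O (x * y). Proof. by case: Oord. Qed.
Let p2 k : 0 < 2 ^+ k :> R. Proof. by rewrite exprn_gt0. Qed.
Let H0 : 0 < coord_const. Proof. exact: lt_le_trans coord_const_ge1. Qed.
Let M0 : 0 < norm_const. Proof. exact: lt_le_trans norm_const_ge1. Qed.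

Let stretch_zcomb i : w i = zcomb b ((2 ^+ a i : int) *: delta_mx 0 i).
Proof.
by rewrite zcombZ zcomb_delta /stretch -scaler_int rmorphXn.
Qed.

Lemma embnorm_stretch i : N (w i) <= norm_const * 2 ^+ a i.
Proof.
have -> : N (w i) = 2 ^+ a i * N (b i).
  apply/eqP; rewrite -(eqrXn2 (_ : 0 < 2)%N) ?mulr_ge0 ?embnorm_ge0 ?(ltW (p2 _)) //.
  rewrite stretch_zcomb (embnorm_zcomb nK sP) exprMn.
  have -> : realmx R ((2 ^+ a i : int) *: delta_mx 0 i) = 2 ^+ a i *: realmx R (delta_mx 0 i) :> 'rV_n.
    by apply/rowP => j; rewrite !mxE rmorphM rmorphXn.
  rewrite bformZl bformZr mulrA -expr2 -[b i in X in _ == X](zcomb_delta b).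
  by rewrite (embnorm_zcomb nK sP).
rewrite mulrC ler_pM2r // /norm_const (bigD1 i) //= addrCA lerDl addr_ge0 // sumr_ge0 //.
by move=> j _; apply: embnorm_ge0.
Qed.

(** The coordinate of [x] along [b k] is a nonzero integer multiple of [2^(a_k)], and coordinates
    are bounded by the norm. *)
Lemma coord_bound x k : O x -> qcoord w k x != 0 -> 2 ^+ a k <= coord_const * N x.
Proof.
case=> z _ <-; rewrite (qcoord_zcomb _ _ ww) intr_eq0 => zk.
have zE : zcomb w z = zcomb b (\row_k (z 0 k * 2 ^+ a k)).
  rewrite !zcombE; apply: eq_bigr => i _; rewrite !mxE /stretch scalerA rmorphM.
  by rewrite rmorphXn.
rewrite -(ler_pXn2r (_ : 0 < 2)%N) ?nnegrE ?mulr_ge0 ?embnorm_ge0 ?(ltW (p2 _)) ?(ltW H0) //.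
have := posdef_coord_le (realmx R (\row_k (z 0 k * 2 ^+ a k))) k (posdef_gram nK sP bb).
rewrite -(embnorm_zcomb nK sP) -zE exprMn !mxE; move: (N _ ^+ 2) (sqr_ge0 (N (zcomb w z))) => y y0 h.
apply: le_trans (_ : (z 0 k * 2 ^+ a k)%:~R ^+ 2 <= _).
  rewrite rmorphM rmorphXn /= exprMn ler_peMl ?sqr_ge0 //.
  by rewrite -rmorphXn /= ler1z; move: zk; move: (z 0 k) => u; nia.
apply: le_trans h _; rewrite mulrC ler_wpM2r //.
apply: le_trans (ler_norm _) _; apply: le_trans (_ : coord_const <= _).
  by rewrite /coord_const (bigD1 k) //= addrCA lerDl addr_ge0 // sumr_ge0.
by rewrite expr2 ler_peMr // ?(ltW H0) // coord_const_ge1.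
Qed.

(** The purpose of the gap [g]: together with [coord_bound] it makes every element with a nonzero
    coordinate at [k] longer than each [w i] with [i < k]. *)
Lemma gap_lt (i k : 'I_n) : (i < k)%N -> coord_const * (norm_const * 2 ^+ a i) < 2 ^+ a k.
Proof.
move=> ik; rewrite mulrA; apply: lt_le_trans (_ : 2 ^+ g * 2 ^+ a i <= _).
  by rewrite ltr_pM2r.
by rewrite -exprD ler_eXn2l ?ltr1n // addnC; apply: ag.
Qed.

(** Let [m] be the largest index at which a short element has a nonzero coordinate. Then [F m]
    contains all short elements, and all [w k] with [k < m] are short. *)
Lemma V_stretch (r : R) : 0 < r -> V r = 0%VS \/
  exists2 m, V r = F m & exists2 x, short O r x & qcoord w m x != 0.
Proof.
move=> r0; have [[m0 m0P]|no] :=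
    pselect (exists m, exists2 x, short O r x & qcoord w m x != 0); last first.
  left; apply/eqP; rewrite -subv0; apply: vspan_sub => x xs.
  rewrite (is_basis_sum x ww); apply: memv_suml => k _.
  have [->|k0] := eqVneq (qcoord w k x) 0; first by rewrite scale0r mem0v.
  by case: no; exists k, x.
right; pose P m := `[< exists2 x, short O r x & qcoord w m x != 0 >].
have Pm0 : P m0 by apply/asboolP.
case: (arg_maxnP (fun m : 'I_n => m : nat) Pm0) => m /asboolP mP mmax; exists m => //.
have [x xs xm] := mP; have [_ _ wF] := wA.
have wV (k : 'I_n) : (k < m)%N -> w k \in V r.
  move=> km; apply: sub_vspan; split; first exact: mem_Zbasis wO.
  apply: le_trans (embnorm_stretch k) _; apply: le_trans xs.2.
  rewrite -(ler_pM2l H0); apply/ltW/(lt_le_trans (gap_lt km)).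
  exact: coord_bound xs.1 xm.
have vanish y : short O r y -> forall k : 'I_n, (m < k)%N -> qcoord w k y = 0.
  move=> ys k mk; apply/eqP/negPn/negP => k0.
  have /mmax : P k by apply/asboolP; exists y.
  by rewrite /= leqNgt mk.
apply/eqP; rewrite eqEsubv; apply/andP; split.
  by apply: vspan_sub => y ys; apply/wF => k; apply: vanish.
(* [w m] itself may be too long; it is recovered from [x] by removing the terms below [m], those
   above being zero. *)
have wm : w m \in V r.
  have -> : w m = (qcoord w m x)^-1 *: (x - \sum_(k | k != m) qcoord w k x *: w k).
    rewrite {2}(is_basis_sum x ww) (bigD1 m) //= addrK scalerA mulVf // scale1r //.
  apply: memvZ; apply: rpredB; first exact: sub_vspan.
  apply: memv_suml => k km.
  have [kl|mk] := ltnP k m; first by rewrite memvZ // wV.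
  rewrite (vanish x xs) ?scale0r ?mem0v // ltn_neqAle mk andbT eq_sym.
  by apply: contra km => /eqP km; apply/eqP/ord_inj.
apply/subvP => y /wF yF; rewrite (is_basis_sum y ww); apply: memv_suml => k _.
case: (ltngtP k m) => [km|mk|/ord_inj ->]; [|by rewrite yF // scale0r mem0v|exact: memvZ].
by rewrite memvZ // wV.
Qed.

Lemma V_attained (m : 'I_n) : V (norm_const * 2 ^+ a m) = F m.
Proof.
have [F0 _ Fm dF] := Fflag; have [_ _ wF] := wA.
set r := _ * _; have r0 : 0 < r by rewrite mulr_gt0.
have FV : (F m <= V r)%VS.
  apply/subvP => y /wF yF; rewrite (is_basis_sum y ww); apply: memv_suml => k _.
  have [km|mk] := leqP k m; last by rewrite yF // scale0r mem0v.
  apply: memvZ; apply: sub_vspan; split; first exact: mem_Zbasis wO.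
  apply: le_trans (embnorm_stretch k) _; rewrite ler_pM2l // ler_eXn2l ?ltr1n //.
  exact: am.
have [V0|[k Vk [x xs xk]]] := V_stretch r0.
  by have := dimvS FV; rewrite V0 dimv0 dF.
apply/eqP; rewrite eqEsubv FV andbT Vk Fm // leqNgt; apply/negP => mk.
have := coord_bound xs.1 xk; rewrite leNgt => /negP; apply.
apply: le_lt_trans (gap_lt mk); rewrite ler_pM2l //; exact: xs.2.
Qed.

Lemma succ_min_stretch (i : 'I_n) :
  lam i <= norm_const * 2 ^+ a i /\ 2 ^+ a i <= coord_const * lam i.
Proof.
have [_ _ _ dF] := Fflag; split.
  by apply: (succ_min_le nK sP wO OM) => //; rewrite ?mulr_gt0 // V_attained dF.
have dl := succ_min_dim nK sP wO OM (ltn_ord i).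
have [V0|[k Vk [x xs xk]]] := V_stretch (succ_min_gt0 nK sP wO OM (ltn_ord i)).
  by move: dl; rewrite V0 dimv0.
move: dl; rewrite Vk dF ltnS => ik.
apply: le_trans (_ : 2 ^+ a k <= _); first by rewrite ler_eXn2l ?ltr1n // am.
by apply: le_trans (coord_bound xs.1 xk) _; rewrite ler_pM2l //; exact: xs.2.
Qed.

(** By [V_stretch] and [V_attained] the nonzero spans of short elements are exactly the [F m]; the
    zero span generates Q, as [F ord0] does. *)
Lemma stretch_tower_type T : flag_tower_type F T -> order_tower_type R O T.
Proof.
rewrite /flag_tower_type /order_tower_type.
suff -> : [set gen_field (short O r) | r in [set r : R | 0 < r]] =
  [set gen_field [set` F i] | i in [set: 'I_n]] by [].
have [F0 _ _ _] := Fflag.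
have gV (r : R) : gen_field (short O r) = gen_field [set` V r].
  by apply: val_inj; rewrite /= /gen_field vspan_vs.
apply/seteqP; split => [_ [r /= r0 <-]|_ [m _ <-]].
  have [V0|[k Vk _]] := V_stretch r0; last by exists k; rewrite // gV Vk.
  exists ord0 => //; rewrite gV V0; apply: val_inj.
  by rewrite /= /gen_field !vspan_vs F0 agenv1 agenv01.
exists (norm_const * 2 ^+ a m) => /=; first by rewrite mulr_gt0.
by rewrite gV V_attained.
Qed.

Lemma abs_disc_stretch : abs_disc O = (2 ^+ (\sum_i a i)) ^+ 2 * `|basis_disc b|.
Proof.
rewrite (abs_disc_basis R wO).
pose D : 'M[int]_n := diag_mx (\row_i 2 ^+ a i).
have -> : stretch b a = fun i => zcomb b (row i D).
  by apply/funext => i; rewrite row_diag_mx mxE stretch_zcomb.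
rewrite (basis_disc_zcomb nK sP) det_diag normrM ger0_norm ?sqr_ge0 //; congr (_ ^+ 2 * _).
rewrite rmorph_prod -prodrXr; apply: eq_bigr => i _.
by rewrite mxE rmorphXn.
Qed.

End StretchedOrder.

(** * Integer exponents attached to a point of the polytope *)

Section Exponents.
Variables (R : realType) (d : nat).
Local Notation n := d.+1.
Variables (t : 'I_n -> 'I_n -> 'I_n) (x : 'rV[R]_d).
Hypothesis xP : polytope t x.
Local Notation y := (shifted x).

Lemma shifted_ge0 i : 0 <= y i.
Proof.
have [_ x0 _ _] := xP.
by case: (unliftP ord0 i) => [j ->|->]; rewrite ?shifted0 ?shiftedS.
Qed.

Lemma shifted_mono (i j : 'I_n) : (i <= j)%N -> y i <= y j.
Proof.
have [_ _ xm _] := xP.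
case: (unliftP ord0 i) => [i' ->|->]; last by rewrite shifted0 shifted_ge0.
case: (unliftP ord0 j) => [j' ->|-> //]; rewrite !shiftedS; exact: xm.
Qed.

Lemma shifted_sum : \sum_i y i = 1 / 2.
Proof.
have [<- _ _ _] := xP; rewrite big_ord_recl shifted0 add0r.
by apply: eq_bigr => j _; rewrite shiftedS.
Qed.

Lemma shifted_triangle (i j : 'I_n) : (0 < i)%N -> (0 < j)%N -> y (t i j) <= y i + y j.
Proof. by have [_ _ _] := xP; apply. Qed.

Definition ceiln (u : R) : nat := absz (Num.ceil u).

Lemma ceilnE u : 0 <= u -> (ceiln u)%:Z = Num.ceil u.
Proof.
move=> u0; by rewrite /ceiln gez0_abs // ceil_ge0; apply: lt_le_trans u0; rewrite ltrN10.
Qed.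

Lemma ceiln_mono u v : 0 <= u -> u <= v -> (ceiln u <= ceiln v)%N.
Proof.
move=> u0 uv; rewrite -lez_nat !ceilnE //; last exact: le_trans uv.
exact: le_ceil.
Qed.

Lemma ceiln_add u v : 0 <= u -> 0 <= v -> (ceiln (u + v) <= ceiln u + ceiln v)%N.
Proof.
move=> u0 v0; rewrite -lez_nat PoszD !ceilnE ?addr_ge0 // ceil_le_int intrD.
by rewrite lerD // ceil_ge.
Qed.

Lemma ceiln_bounds u : 0 <= u -> u <= (ceiln u)%:R <= u + 1.
Proof.
move=> u0; have -> : (ceiln u)%:R = (Num.ceil u)%:~R :> R by rewrite -ceilnE.
have /andP[h1 ->] := ceil_itv u; move: h1; rewrite intrB => h1.
by rewrite -lerBlDr ltW.
Qed.

(* The terms [g * (d + i)] force gaps of size [g] between consecutive exponents;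
   as [d + t <= (d + i) + (d + j)] for all indices, they do not disturb the
   inequalities of the polytope. *)
Definition exponent (g l : nat) (i : 'I_n) : nat :=
  if i == ord0 then 0%N else (ceiln (l%:R * y i) + g * (d + i))%N.

Lemma exponent0 g l : exponent g l ord0 = 0%N.
Proof. by rewrite /exponent eqxx. Qed.

Let ly_ge0 (l : nat) i : 0 <= l%:R * y i.
Proof. by rewrite mulr_ge0 ?shifted_ge0. Qed.

Lemma exponent_mono g l (i j : 'I_n) : (i <= j)%N -> (exponent g l i <= exponent g l j)%N.
Proof.
move=> ij; rewrite /exponent; case: eqVneq => // i0; case: eqVneq => [j0|_].
  by case/eqP: i0; apply/ord_inj/eqP; rewrite -leqn0 (leq_trans ij) // j0.
apply: leq_add; last by rewrite leq_mul2l leq_add2l ij orbT.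
by apply: ceiln_mono => //; rewrite ler_wpM2l // shifted_mono.
Qed.

Lemma exponent_gap g l (i j : 'I_n) : (i < j)%N -> (exponent g l i + g <= exponent g l j)%N.
Proof.
move=> ij; rewrite /exponent; have -> : (j == ord0) = false.
  by apply/negbTE; apply: contraTneq ij => ->.
case: eqVneq => [_|_]; first by nia.
have := ceiln_mono (ly_ge0 l i) (ler_wpM2l (ler0n _ l) (shifted_mono (ltnW ij))).
by move: ij; move: (ceiln _) (ceiln _) (nat_of_ord i) (nat_of_ord j) => *; nia.
Qed.

Lemma exponent_triangle g l (i j : 'I_n) : (0 < i)%N -> (0 < j)%N ->
  (exponent g l (t i j) <= exponent g l i + exponent g l j)%N.
Proof.
move=> i0 j0; rewrite /exponent; case: eqVneq => // _.
have -> : (i == ord0) = false by apply/negbTE; apply: contraTneq i0 => ->.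
have -> : (j == ord0) = false by apply/negbTE; apply: contraTneq j0 => ->.
have h : (ceiln (l%:R * y (t i j)) <= ceiln (l%:R * y i) + ceiln (l%:R * y j))%N.
  apply: leq_trans (ceiln_add _ _) => //; apply: ceiln_mono => //.
  by rewrite -mulrDr ler_wpM2l // shifted_triangle.
have := ltn_ord (t i j); rewrite ltnS; move: h.
move: (ceiln _) (ceiln _) (ceiln _) (nat_of_ord (t i j)) (nat_of_ord i) (nat_of_ord j) i0 j0.
by move=> *; nia.
Qed.

Lemma exponent_approx g l i :
  `|(exponent g l i)%:R - l%:R * y i| <= 1 + (g * (d + d))%:R.
Proof.
rewrite /exponent; case: eqVneq => [->|_].
  by rewrite shifted0 mulr0 subrr normr0 addr_ge0.
have /andP[h1 h2] := ceiln_bounds (ly_ge0 l i).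
have h3 : (g * (d + i))%:R <= (g * (d + d))%:R :> R.
  by rewrite ler_nat leq_mul2l leq_add2l -ltnS ltn_ord orbT.
have h4 : 0 <= (g * (d + i))%:R :> R by [].
by rewrite natrD ler_norml; apply/andP; split; lra.
Qed.

End Exponents.

(** The exponents follow [l x_i] up to bounded errors. As the coordinates sum to 1/2 and the
    discriminant is [2^(2 \sum a_i)] times a constant, its logarithm is near [l ln 2], and those of
    the minima are near [x_j l ln 2]. *)
Lemma polytope_orders (R : realType) (d : nat) (T : seq nat) (K : fieldExtType rat)
    (F : 'I_d.+1 -> {vspace K}) (x : 'rV[R]_d) :
  \dim {:K} = d.+1 -> is_flag F -> flag_tower_type F T -> polytope (flag_type F) x ->
  exists (c : R) (A : nat -> set K), forall l : nat,
  [/\ is_order (A l), order_tower_type R (A l) T,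
   `|ln (ratr (abs_disc (A l))) - l%:R * ln 2| <= c
  & forall j : 'I_d, `|ln (succ_min R (A l) j.+1)
                       - x 0 j * ln (ratr (abs_disc (A l)))| <= c].
Proof.
move=> dK Fflag FT xP; have nK := esym dK.
have [s sP] : exists s : 'I_d.+1 -> {rmorphism K -> R[i]}, embedding_enum s.
  by rewrite nK; apply: embedding_enum_exists.
have [b bA bZ] := adapted_integral_basis nK Fflag.
have [bb _ _] := bA.
pose H := coord_const s b; pose M : R := norm_const R b.
have H1 : 1 <= H := coord_const_ge1 _ _.
have M1 : 1 <= M := norm_const_ge1 _ _.
have H0 : 0 < H := lt_le_trans ltr01 H1.
have M0 : 0 < M := lt_le_trans ltr01 M1.
(* [g] exceeds the product of the two constants, and [2^g > g]. *)
pose g := (Num.truncn (H * M)).+1.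
have gP : H * M < 2 ^+ g.
  apply: lt_trans (truncnS_gt _) _; rewrite -natrX ltr_nat.
  exact: ltn_expl.
pose a := exponent x g.
have a0 l : a l ord0 = 0%N := exponent0 x g l.
have am l (i j : 'I_d.+1) : (i <= j)%N -> (a l i <= a l j)%N by apply: (exponent_mono xP).
have at_ l (i j : 'I_d.+1) : (0 < i)%N -> (0 < j)%N ->
    (a l (flag_type F i j) <= a l i + a l j)%N by apply: (exponent_triangle xP).
have ag l (i j : 'I_d.+1) : (i < j)%N -> (a l i + g <= a l j)%N by apply: (exponent_gap xP).
pose E : R := 1 + (g * (d + d))%:R.
have aE l i : `|(a l i)%:R - l%:R * shifted x i| <= E by apply: (exponent_approx xP _ _ _).
have ln2 : 0 < ln 2 :> R by rewrite ln_gt0 // ltr1n.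
pose D0 : R := ratr `|basis_disc b|.
have D00 : 0 < D0 by rewrite ltr0q normr_gt0 (basis_disc_neq0 nK sP bb).
pose c1 := ln M + ln H + E * ln 2.
pose c2 := 2 * d.+1%:R * E * ln 2 + `|ln D0|.
have E0 : 0 <= E by rewrite addr_ge0.
have c10 : 0 <= c1 by rewrite !addr_ge0 ?ln_ge0 // mulr_ge0 // ltW.
have c20 : 0 <= c2 by rewrite addr_ge0 // !mulr_ge0 // ltW.
exists (c1 + c2), (fun l => range (zcomb (stretch b (a l)))) => l.
have Od := stretch_order nK Fflag bA bZ (a0 l) (am l) (at_ l).
set O := range _.
have lamP i := succ_min_stretch nK sP Fflag bA bZ gP (a0 l) (am l) (at_ l) (ag l) i.
have lnD : ln (ratr (abs_disc O)) = 2 * (\sum_i (a l i)%:R) * ln 2 + ln D0.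
  rewrite (abs_disc_stretch nK sP bA (a0 l)) rmorphM -/D0 lnM ?posrE //; last first.
    by rewrite ltr0q !exprn_gt0.
  congr (_ + _); rewrite !rmorphXn /= ratr_nat !lnXn ?exprn_gt0 // -natr_sum.
  by rewrite -mulrnA -[LHS]mulr_natl mulnC natrM.
have sumE : `|\sum_i (a l i)%:R - l%:R / 2| <= d.+1%:R * E.
  have -> : l%:R / 2 = \sum_i l%:R * shifted x i :> R.
    by rewrite -mulr_sumr (shifted_sum xP) mul1r.
  rewrite -sumrB; apply: le_trans (ler_norm_sum _ _ _) _.
  have -> : d.+1%:R * E = \sum_(i < d.+1) E by rewrite sumr_const card_ord mulr_natl.
  by apply: ler_sum => i _; apply: aE.
have DL : `|ln (ratr (abs_disc O)) - l%:R * ln 2| <= c2.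
  rewrite lnD.
  have -> : 2 * (\sum_i (a l i)%:R) * ln 2 + ln D0 - l%:R * ln 2 =
     2 * (\sum_i (a l i)%:R - l%:R / 2) * ln 2 + ln D0.
    by field.
  apply: le_trans (ler_normD _ _) _; rewrite lerD2r !normrM (gtr0_norm ln2) ler_pM2r //.
  by rewrite -mulrA normr_nat ler_pM2l.
split => //.
- exact: (stretch_tower_type nK sP Fflag bA gP (a0 l) (am l) (ag l) FT).
- by apply: le_trans DL _; rewrite lerDr.
- move=> j; have [l1 l2] := lamP (lift ord0 j); rewrite -/O /= in l1 l2.
  pose i : 'I_d.+1 := lift ord0 j; rewrite -/i in l1 l2.
  rewrite -[bump 0 j]/j.+1 in l1 l2.
  set lam := succ_min R O j.+1 in l1 l2 *.
  have p2 : 0 < 2 ^+ a l i :> R by rewrite exprn_gt0.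
  have lam0 : 0 < lam by rewrite -(pmulr_rgt0 _ H0); apply: lt_le_trans l2.
  have lnp : ln (2 ^+ a l i) = (a l i)%:R * ln 2 :> R by rewrite lnXn // mulr_natl.
  have h1 : ln lam <= ln M + (a l i)%:R * ln 2.
    by rewrite -lnp -lnM ?posrE // ler_ln ?posrE // mulr_gt0.
  have h2 : (a l i)%:R * ln 2 <= ln H + ln lam.
    by rewrite -lnp -lnM ?posrE // ler_ln ?posrE // mulr_gt0.
  have h3 := aE l i.
  have xE : shifted x i = x 0 j by rewrite shiftedS.
  have x0 : 0 <= x 0 j by rewrite -xE (shifted_ge0 xP).
  (* With [x_j <= 1], replacing [l ln 2] by the logarithm of the discriminant costs at most [c2]. *)
  have x1 : x 0 j <= 1.
    have := shifted_sum xP; rewrite (bigD1 i) //= xE.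
    have : 0 <= \sum_(k | k != i) shifted x k by apply: sumr_ge0 => k _; apply: (shifted_ge0 xP _).
    by clear; lra.
  have H0' : 0 <= ln H by rewrite ln_ge0.
  have M0' : 0 <= ln M by rewrite ln_ge0.
  have h4 : `|ln lam - l%:R * x 0 j * ln 2| <= c1.
    have : `|((a l i)%:R - l%:R * shifted x i) * ln 2| <= E * ln 2.
      by rewrite normrM (gtr0_norm ln2) ler_pM2r.
    rewrite xE /c1 !ler_norml mulrBl => /andP[h5 h6].
    by move: h1 h2 h5 h6 H0' M0'; clear; move=> *; apply/andP; split; lra.
  have -> : ln lam - x 0 j * ln (ratr (abs_disc O)) = (ln lam - l%:R * x 0 j * ln 2)
     - x 0 j * (ln (ratr (abs_disc O)) - l%:R * ln 2).
    by ring.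
  apply: le_trans (ler_normB _ _) _; apply: lerD => //.
  rewrite normrM (ger0_norm x0); apply: le_trans DL.
  by rewrite ler_piMl.
Qed.

(** The family is the isomorphism closure of the orders [A l]; the logarithms of their discriminants
    are unbounded and invariant under isomorphism, which rules out finitely many classes. *)
Lemma polytope_sub_Spe (R : realType) (d : nat) (T : seq nat)
    (C : fieldExtType rat -> Prop) (K : fieldExtType rat)
    (F : 'I_d.+1 -> {vspace K}) (x : 'rV[R]_d) :
  C K -> \dim {:K} = d.+1 -> is_flag F -> flag_tower_type F T -> polytope (flag_type F) x ->
  Spe (fun O => exists K, C K /\ orders_of_type R T K O) x.
Proof.
move=> CK dK Fflag FT xP; have [c [A AP]] := polytope_orders dK Fflag FT xP.
have hA l : is_order (A l) by case: (AP l).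
pose Ol l := NumOrder (hA l).
pose D l : R := ratr (abs_disc (A l)).
have ln2 : 0 < ln 2 :> R by rewrite ln_gt0 // ltr1n.
have large (B : R) : exists l0 : nat, forall l, (l0 <= l)%N -> B < ln (D l).
  exists (Num.truncn (`|B + c| / ln 2)).+1 => l ll.
  have h : `|B + c| / ln 2 < l%:R.
    by apply: lt_le_trans (truncnS_gt _) _; rewrite ler_nat.
  have {}h : `|B + c| < l%:R * ln 2 by rewrite -ltr_pdivrMr.
  have [_ _ + _] := AP l; rewrite -/(D l) ler_norml => /andP[h1 _].
  by have := ler_norm (B + c); move: h h1; clear; lra.
exists (fun O => exists l, order_iso (Ol l) O); split.
- by move=> O O' OO' [l lO]; exists l; apply: order_iso_trans OO'.
- move=> O [l lO]; exists K; split => //; exists (A l), (hA l); split => //.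
  by case: (AP l).
split.
- move=> [N [r rP]].
  pose B : R := \sum_(i < N) `|ln (ratr (abs_disc (oset (r i))))|.
  have [l0 l0P] := large B; have := l0P l0 (leqnn _).
  have [i iO] : exists i, order_iso (r i) (Ol l0).
    apply: rP; exists l0; exists id; split => //.
    by split => // z Oz; exists z.
  have [_ dE] := order_iso_invariants R iO.
  rewrite /D -[A l0]/(oset (Ol l0)) dE ltNge => /negP; apply.
  rewrite /B (bigD1 i) //=; apply: le_trans (ler_norm _) _.
  by rewrite lerDl sumr_ge0.
(* From [l0] on, the error [c / ln (D l)] is below [e], so only orders with [l < l0] can be far from
   [x]. *)
- move=> e e0; have [l0 l0P] := large (`|c| / e).
  exists l0, (fun i : 'I_l0 => Ol i) => O [[l lO] far].
  have [ll|ll] := ltnP l l0; first by exists (Ordinal ll).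
  case: far => j; have [sE dE] := order_iso_invariants R lO.
  rewrite mxE sE dE /= -/(D l).
  have h1 := l0P l ll.
  have L0 : 0 < ln (D l) by apply: le_lt_trans h1; rewrite divr_ge0 // ltW.
  have [_ _ _ /(_ j) h2] := AP l; rewrite -/(D l) in h2.
  have -> : ln (succ_min R (A l) j.+1) / ln (D l) - x 0 j =
     (ln (succ_min R (A l) j.+1) - x 0 j * ln (D l)) / ln (D l).
    by rewrite mulrBl mulfK // gt_eqF.
  rewrite normrM normfV (gtr0_norm L0) ltr_pdivrMr // [e * _]mulrC -ltr_pdivrMr //.
  apply: le_lt_trans h1; rewrite ler_pM2r ?invr_gt0 //.
  by apply: le_trans h2 _; apply: ler_norm.
Qed.

Theorem theorem1p32 (R : realType) (d : nat) (T : seq nat)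
  (C : fieldExtType rat -> Prop) :
  all (fun m => 1 < m)%N T ->
  (\prod_(m <- T) m)%N = d.+1 ->
  iso_closed_fields C ->
  (forall K, C K -> \dim {:K} = d.+1) ->
  @Spe R d (fun O => exists K, C K /\ orders_of_type R T K O) =
  [set x : 'rV[R]_d | exists (K : fieldExtType rat) (F : 'I_d.+1 -> {vspace K}),
    [/\ C K, is_flag F, flag_tower_type F T & polytope (flag_type F) x]].
Proof.
move=> _ _ _ Cd; apply/seteqP; split => x; first exact: Spe_sub_polytopes.
by case=> K [F [CK Fflag FT xP]]; exact: (polytope_sub_Spe CK (Cd _ CK) Fflag FT xP).
Qed.
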